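(* Let $P\colon \mathcal{C}^{\mathrm{op}}\to \mathsf{InfSl}$ be a lex primary doctrine. Then the following are equivalent: 1. $P$ is an $\exists$-supercompactifiable doctrine; 2. the weak subobject doctrine $\Psi_{\mathcal{G}_P}\colon \mathcal{G}_P^{\mathrm{op}}\to\mathsf{InfSl}$ of the category of points $\mathcal{G}_P$ is a full tripos; 3. the full existential completion $P^{\exists}\colon \mathcal{C}^{\mathrm{op}}\to\mathsf{InfSl}$ is a full tripos; 4. the exact category of points $\mathsf{E}_P:=(\mathcal{G}_P)_{\mathsf{ex}/\mathsf{lex}}$ is a topos.
   Context: A lex primary doctrine is a functor $P\colon \mathcal{C}^{\mathrm{op}}\to\mathsf{InfSl}$, where $\mathcal{C}$ has finite limits and $\mathsf{InfSl}$ is the category of inf-semilattices (posets with finite meets, including top) and their homomorphisms. For $f\colon A\to B$ write $P_f\colon P(B)\to P(A)$. $P$ is full existential if for every arrow $f$ of $\mathcal{C}$ the map $P_f$ has a left adjoint $\exists_f$, satisfying Beck–Chevalley (for pullback squares) and Frobenius reciprocity. $P$ is a full first-order hyperdoctrine if it is full existential, each $P(A)$ is a Heyting algebra, each $P_f$ is a Heyting algebra homomorphism, and each $P_f$ also has a right adjoint $\forall_f$, these satisfying Beck–Chevalley. $P$ has weak power objects if for every object $X$ there are an object $\mathrm{P}X$ and an element $\in_X\in P(X\times\mathrm{P}X)$ such that for every object $Y$ and $\beta\in P(X\times Y)$ there is an arrow $\{\beta\}_X\colon Y\to\mathrm{P}X$ with $\beta=P_{\mathrm{id}_X\times\{\beta\}_X}(\in_X)$.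 A full tripos is a full first-order hyperdoctrine with weak power objects. Category of points $\mathcal{G}_P$: objects are pairs $(A,\alpha)$ with $\alpha\in P(A)$; arrows $(A,\alpha)\to(B,\beta)$ are arrows $f\colon A\to B$ of $\mathcal{C}$ with $\alpha\le P_f(\beta)$. It has finite limits. Weak subobject doctrine $\Psi_{\mathcal{D}}$ of a category $\mathcal{D}$ with finite limits: $\Psi_{\mathcal{D}}(A)$ is the poset reflection of the slice $\mathcal{D}/A$, with reindexing by pullback. Full existential completion $P^{\exists}$: $P^{\exists}(A)$ is the poset reflection of the preorder of pairs $(B\xrightarrow{f}A,\alpha)$ with $\alpha\in P(B)$, where $(B\xrightarrow{f}A,\alpha)\le(C\xrightarrow{g}A,\beta)$ iff there is $h\colon B\to C$ with $f=gh$ and $\alpha\le P_h(\beta)$; for $f\colon A\to B$, $P^{\exists}_f(C\xrightarrow{g}B,\beta):=(D\xrightarrow{f^*g}A,P_{g^*f}(\beta))$, where $D$ is the pullback of $f$ and $g$ with projections $f^*g\colon D\to A$ and $g^*f\colon D\to C$. Weak dependent products: a weak dependent product of $f\colon X\to J$ along $g\colon J\to I$ consists of an arrow $h\colon Z\to I$ and an arrow $e\colon E\to X$, where $E$ is the pullback of $g$ and $h$, such that $fe$ is the projection $E\to J$, and such that for any other such data $h'\colon Z'\to I$, $e'\colon E'\to X$ (with $E'$ the pullback of $g$ and $h'$, and $fe'$ the projection $E'\to J$) there is $w\colon Z'\to Z$ with $h'=hw$ and $e'=ek$, where $k\colon E'\to E$ is induced by $w$. A category has weak dependent products if these exist for all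 such $f,g$. Generic proof: an arrow $\theta\colon\Theta\to\Lambda$ such that for every arrow $f\colon Y\to X$ there is $\upsilon_f\colon X\to\Lambda$ such that $f$ factors through the pullback $\upsilon_f^*\theta$ of $\theta$ along $\upsilon_f$ and $\upsilon_f^*\theta$ factors through $f$. $P$ is $\exists$-supercompactifiable if $\mathcal{G}_P$ has weak dependent products and a generic proof. $\mathcal{D}_{\mathsf{ex}/\mathsf{lex}}$ is the exact completion of a finite-limit category $\mathcal{D}$ in the sense of Carboni (the free exact category on the finite-limit category $\mathcal{D}$). ''Topos'' means elementary topos. *)

(* Defs.v *)
From Corelib Require Import ssreflect ssrfun ssrbool.
From Stdlib Require Import RelationClasses FunctionalExtensionality.
From Stdlib Require Import PropExtensionality ProofIrrelevance IndefiniteDescription.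

Set Implicit Arguments.
Unset Strict Implicit.
Unset Printing Implicit Defensive.

Definition quot {A : Type} (R : A -> A -> Prop) : Type :=
  {S : A -> Prop | exists a, S = R a}.

Definition cls {A : Type} (R : A -> A -> Prop) (a : A) : quot R :=
  exist _ (R a) (ex_intro _ a eq_refl).

Definition repr {A : Type} {R : A -> A -> Prop} (q : quot R) : A :=
  proj1_sig (constructive_indefinite_description _ (proj2_sig q)).

Lemma sig_eq {A : Type} {Q : A -> Prop} (x y : {a | Q a}) :
  proj1_sig x = proj1_sig y -> x = y.
Proof.
case: x y => [x hx] [y hy] /= e; subst y.
by rewrite (proof_irrelevance _ hx hy).
Qed.

Lemma reprK {A : Type} {R : A -> A -> Prop} (q : quot R) : cls R (repr q) = q.
Proof.
apply: sig_eq => /=; rewrite /repr.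
by case: constructive_indefinite_description.
Qed.

Lemma cls_eq {A : Type} {R : A -> A -> Prop} (eR : Equivalence R) (a b : A) :
  cls R a = cls R b <-> R a b.
Proof.
split=> [/(f_equal (@proj1_sig _ _)) /= ->|h]; first by reflexivity.
apply: sig_eq => /=; apply: functional_extensionality => c.
apply: propositional_extensionality; split=> h'.
  by transitivity a => //; symmetry.
by transitivity b.
Qed.

Lemma repr_cls {A : Type} {R : A -> A -> Prop} (eR : Equivalence R) (a : A) :
  R (repr (cls R a)) a.
Proof. by apply/(cls_eq eR); rewrite reprK. Qed.

Record Category := {
  Ob :> Type;
  Hom : Ob -> Ob -> Type;
  idm : forall A, Hom A A;
  comp : forall A B D, Hom B D -> Hom A B -> Hom A D;
  comp_idl : forall A B (f : Hom A B), comp (idm B) f = f;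
  comp_idr : forall A B (f : Hom A B), comp f (idm A) = f;
  compA : forall A B D E (h : Hom D E) (g : Hom B D) (f : Hom A B),
    comp h (comp g f) = comp (comp h g) f
}.

Arguments Hom {c} A B.
Arguments idm {c} A.
Arguments comp {c A B D} g f.

Declare Scope cat_scope.
Open Scope cat_scope.
Notation "A ~> B" := (Hom A B) (at level 70, no associativity) : cat_scope.
Notation "g ∘ f" := (comp g f) (at level 40, left associativity) : cat_scope.

Definition IsTerminal {C : Category} (T : C) : Prop :=
  forall X : C, exists! f : X ~> T, True.

Definition IsPullback {C : Category} {A B D X : C}
    (f : A ~> D) (g : B ~> D) (p : X ~> A) (q : X ~> B) : Prop :=
  f ∘ p = g ∘ q /\
  forall (Y : C) (a : Y ~> A) (b : Y ~> B), f ∘ a = g ∘ b ->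
    exists! h : Y ~> X, p ∘ h = a /\ q ∘ h = b.

Definition IsMono {C : Category} {A B : C} (m : A ~> B) : Prop :=
  forall (X : C) (u v : X ~> A), m ∘ u = m ∘ v -> u = v.

(* Chosen finite limits, in the form of a terminal object and pullbacks. *)
Class FinLim (C : Category) := {
  one : C;
  oneP : IsTerminal one;
  pb : forall {A B D : C}, A ~> D -> B ~> D -> C;
  pb1 : forall {A B D : C} (f : A ~> D) (g : B ~> D), pb f g ~> A;
  pb2 : forall {A B D : C} (f : A ~> D) (g : B ~> D), pb f g ~> B;
  pbP : forall {A B D : C} (f : A ~> D) (g : B ~> D),
    IsPullback f g (pb1 f g) (pb2 f g)
}.

(* Keeps the search from looping on [FinLim ?C]. *)
#[global] Hint Mode FinLim ! : typeclass_instances.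

Section FiniteLimits.
Context {C : Category} {L : FinLim C}.

Definition bang (X : C) : X ~> one :=
  proj1_sig (constructive_indefinite_description _ (oneP X)).

Lemma bang_uniq {X : C} (f g : X ~> one) : f = g.
Proof. by case: (oneP X) => h [_ u]; rewrite -(u f I) -(u g I). Qed.

Lemma pb_sq {A B D : C} (f : A ~> D) (g : B ~> D) :
  f ∘ pb1 f g = g ∘ pb2 f g.
Proof. by case: (pbP f g). Qed.

Definition pb_pair {A B D X : C} {f : A ~> D} {g : B ~> D}
    (a : X ~> A) (b : X ~> B) (e : f ∘ a = g ∘ b) : X ~> pb f g :=
  proj1_sig (constructive_indefinite_description _ (proj2 (pbP f g) X a b e)).

Lemma pb_pair1 {A B D X : C} {f : A ~> D} {g : B ~> D}
    (a : X ~> A) (b : X ~> B) (e : f ∘ a = g ∘ b) :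
  pb1 f g ∘ pb_pair e = a.
Proof.
by rewrite /pb_pair; case: constructive_indefinite_description => h [] [].
Qed.

Lemma pb_pair2 {A B D X : C} {f : A ~> D} {g : B ~> D}
    (a : X ~> A) (b : X ~> B) (e : f ∘ a = g ∘ b) :
  pb2 f g ∘ pb_pair e = b.
Proof.
by rewrite /pb_pair; case: constructive_indefinite_description => h [] [].
Qed.

Lemma pb_ext {A B D X : C} {f : A ~> D} {g : B ~> D} (u v : X ~> pb f g) :
  pb1 f g ∘ u = pb1 f g ∘ v -> pb2 f g ∘ u = pb2 f g ∘ v -> u = v.
Proof.
move=> e1 e2.
have e : f ∘ (pb1 f g ∘ v) = g ∘ (pb2 f g ∘ v) by rewrite !compA pb_sq.
by case: (proj2 (pbP f g) X _ _ e) => h [_ hu]; rewrite -(hu u) // -(hu v).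
Qed.

Definition prod (A B : C) : C := pb (bang A) (bang B).
Definition fst {A B : C} : prod A B ~> A := pb1 (bang A) (bang B).
Definition snd {A B : C} : prod A B ~> B := pb2 (bang A) (bang B).
Definition pair {X A B : C} (a : X ~> A) (b : X ~> B) : X ~> prod A B :=
  pb_pair (bang_uniq (bang A ∘ a) (bang B ∘ b)).
Definition prod_map {A A' B B' : C} (f : A ~> A') (g : B ~> B') :
  prod A B ~> prod A' B' := pair (f ∘ fst) (g ∘ snd).

End FiniteLimits.

Record InfSl := {
  car :> Type;
  le : car -> car -> Prop;
  meet : car -> car -> car;
  top : car;
  le_refl : forall x, le x x;
  le_trans : forall y x z, le x y -> le y z -> le x z;
  le_anti : forall x y, le x y -> le y x -> x = y;
  le_meet : forall x y z, le z (meet x y) <-> le z x /\ le z y;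
  le_top : forall x, le x top
}.

Arguments le {i} x y.
Arguments meet {i} x y.
Arguments top {i}.
Notation "x ≤ y" := (le x y) (at level 70, no associativity) : cat_scope.
Notation "x ⊓ y" := (meet x y) (at level 50, left associativity) : cat_scope.

Record InfSlHom (H K : InfSl) := {
  hom_fun :> H -> K;
  hom_meet : forall x y, hom_fun (x ⊓ y) = hom_fun x ⊓ hom_fun y;
  hom_top : hom_fun top = top
}.

Lemma meet_lel {H : InfSl} (x y : H) : x ⊓ y ≤ x.
Proof. by have [] := proj1 (le_meet x y (x ⊓ y)) (le_refl _). Qed.

Lemma meet_ler {H : InfSl} (x y : H) : x ⊓ y ≤ y.
Proof. by have [] := proj1 (le_meet x y (x ⊓ y)) (le_refl _). Qed.

Lemma hom_le {H K : InfSl} (f : InfSlHom H K) (x y : H) : x ≤ y -> f x ≤ f y.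
Proof.
move=> h; have -> : x = x ⊓ y.
  by apply: le_anti; [apply/le_meet; split=> //; exact: le_refl|exact: meet_lel].
by rewrite hom_meet; exact: meet_ler.
Qed.

(* A primary doctrine, i.e. a functor from the opposite of [C] to
   inf-semilattices; it is lex when [C] comes with [FinLim C]. *)
Record Doctrine (C : Category) := {
  fib :> C -> InfSl;
  reidx : forall {A B : C}, A ~> B -> InfSlHom (fib B) (fib A);
  reidx_id : forall (A : C) (x : fib A), reidx (idm A) x = x;
  reidx_comp : forall (A B D : C) (g : B ~> D) (f : A ~> B) (x : fib D),
    reidx (g ∘ f) x = reidx f (reidx g x)
}.

Arguments reidx {C} P {A B} f : rename.

Section Tripos.
Context {C : Category} (P : Doctrine C).

Definition FullExistential : Prop :=
  exists ex : forall A B : C, A ~> B -> P A -> P B,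
  [/\ (forall (A B : C) (f : A ~> B) (x : P A) (y : P B),
         ex A B f x ≤ y <-> x ≤ reidx P f y),
      (forall (A B D X : C) (f : A ~> D) (g : B ~> D) (p : X ~> A) (q : X ~> B),
         IsPullback f g p q ->
         forall x : P A, reidx P g (ex A D f x) = ex X B q (reidx P p x))
    & (forall (A B : C) (f : A ~> B) (x : P A) (y : P B),
         ex A B f (x ⊓ reidx P f y) = ex A B f x ⊓ y)].

Record Heyting (H : InfSl) := {
  bot : H;
  join : H -> H -> H;
  imp : H -> H -> H;
  le_bot : forall x, bot ≤ x;
  le_join : forall x y z, join x y ≤ z <-> x ≤ z /\ y ≤ z;
  le_imp : forall x y z, z ≤ imp x y <-> z ⊓ x ≤ y
}.

Definition IsHeytingHom {H K : InfSl} (hH : Heyting H) (hK : Heyting K)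
    (f : InfSlHom H K) : Prop :=
  [/\ f (bot hH) = bot hK,
      (forall x y, f (join hH x y) = join hK (f x) (f y))
    & (forall x y, f (imp hH x y) = imp hK (f x) (f y))].

Definition FullFirstOrder : Prop :=
  [/\ FullExistential,
      (exists h : forall A : C, Heyting (P A),
         forall (A B : C) (f : A ~> B), IsHeytingHom (h B) (h A) (reidx P f))
    & (exists all : forall A B : C, A ~> B -> P A -> P B,
         (forall (A B : C) (f : A ~> B) (x : P A) (y : P B),
            reidx P f y ≤ x <-> y ≤ all A B f x) /\
         (forall (A B D X : C) (f : A ~> D) (g : B ~> D)
                 (p : X ~> A) (q : X ~> B), IsPullback f g p q ->
            forall x : P A,
              reidx P g (all A D f x) = all X B q (reidx P p x)))].

Definition HasWeakPowerObjects {L : FinLim C} : Prop :=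
  forall X : C, exists (PX : C) (mem : P (prod X PX)),
  forall (Y : C) (b : P (prod X Y)), exists chi : Y ~> PX,
    b = reidx P (prod_map (idm X) chi) mem.

Definition FullTripos {L : FinLim C} : Prop :=
  FullFirstOrder /\ HasWeakPowerObjects.

End Tripos.

Record PreInfSl := {
  pcar :> Type;
  ple : pcar -> pcar -> Prop;
  pmeet : pcar -> pcar -> pcar;
  ptop : pcar;
  ple_refl : forall x, ple x x;
  ple_trans : forall y x z, ple x y -> ple y z -> ple x z;
  ple_meet : forall x y z, ple z (pmeet x y) <-> ple z x /\ ple z y;
  ple_top : forall x, ple x ptop
}.

Arguments ple {p} x y.
Arguments pmeet {p} x y.
Arguments ptop {p}.

Definition peq {H : PreInfSl} (x y : H) : Prop := ple x y /\ ple y x.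

Lemma peq_equiv (H : PreInfSl) : Equivalence (@peq H).
Proof.
split=> [x|x y []|x y z [h1 h2] [h3 h4]]; first by split; exact: ple_refl.
  by split.
by split; apply: (ple_trans (y := y)).
Qed.

Section PosetReflection.
Variable H : PreInfSl.

Definition rle (x y : quot (@peq H)) : Prop := ple (repr x) (repr y).

Lemma rle_cls (x y : H) : rle (cls peq x) (cls peq y) <-> ple x y.
Proof.
rewrite /rle.
have [h1 h2] := repr_cls (peq_equiv H) x; have [h3 h4] := repr_cls (peq_equiv H) y.
split=> h.
  by apply: (ple_trans (y := repr (cls peq x))) => //; exact: ple_trans h h3.
by apply: (ple_trans (y := x)) => //; exact: ple_trans h h4.
Qed.

Lemma rle_refl x : rle x x. Proof. exact: ple_refl. Qed.
Lemma rle_trans y x z : rle x y -> rle y z -> rle x z.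
Proof. exact: ple_trans. Qed.
Lemma rle_anti x y : rle x y -> rle y x -> x = y.
Proof.
by move=> h1 h2; rewrite -(reprK x) -(reprK y); apply/(cls_eq (peq_equiv H)).
Qed.
Definition rmeet (x y : quot (@peq H)) : quot (@peq H) :=
  cls peq (pmeet (repr x) (repr y)).
Lemma rle_meet x y z : rle z (rmeet x y) <-> rle z x /\ rle z y.
Proof. by rewrite -{1}(reprK z) /rmeet rle_cls ple_meet. Qed.
Lemma rle_top x : rle x (cls peq ptop).
Proof. by rewrite -(reprK x) rle_cls; exact: ple_top. Qed.

Definition posetReflection : InfSl :=
  Build_InfSl rle_refl rle_trans rle_anti rle_meet rle_top.

End PosetReflection.

(* An indexed family of meet-preorders, functorial up to equivalence. *)
Record PreDoctrine (C : Category) := {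
  pfib :> C -> PreInfSl;
  pre : forall {A B : C}, A ~> B -> pfib B -> pfib A;
  pre_le : forall (A B : C) (f : A ~> B) (x y : pfib B),
    ple x y -> ple (pre f x) (pre f y);
  pre_meet : forall (A B : C) (f : A ~> B) (x y : pfib B),
    ple (pmeet (pre f x) (pre f y)) (pre f (pmeet x y));
  pre_top : forall (A B : C) (f : A ~> B), ple ptop (pre f ptop);
  pre_id : forall (A : C) (x : pfib A), peq (pre (idm A) x) x;
  pre_comp : forall (A B D : C) (g : B ~> D) (f : A ~> B) (x : pfib D),
    peq (pre (g ∘ f) x) (pre f (pre g x))
}.

Section DoctrineReflection.
Context {C : Category} (P : PreDoctrine C).

Definition rpre {A B : C} (f : A ~> B)
    (x : posetReflection (P B)) : posetReflection (P A) :=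
  cls peq (pre f (repr x)).

Lemma pre_peq {A B : C} (f : A ~> B) (x y : P B) :
  peq x y -> peq (pre f x) (pre f y).
Proof. by case=> h1 h2; split; exact: pre_le. Qed.

Lemma rpre_cls {A B : C} (f : A ~> B) (x : P B) :
  rpre f (cls peq x) = cls peq (pre f x).
Proof.
by apply/(cls_eq (peq_equiv _)); apply: pre_peq; exact: (repr_cls (peq_equiv _)).
Qed.

Lemma rpre_le {A B : C} (f : A ~> B) (x y : posetReflection (P B)) :
  x ≤ y -> rpre f x ≤ rpre f y.
Proof. by move=> h; apply/rle_cls; exact: pre_le. Qed.

Lemma rpre_meet {A B : C} (f : A ~> B) (x y : posetReflection (P B)) :
  rpre f (x ⊓ y) = rpre f x ⊓ rpre f y.
Proof.
apply: le_anti.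
  by apply/le_meet; split; apply: rpre_le; [exact: meet_lel|exact: meet_ler].
have -> : x ⊓ y = cls peq (pmeet (repr x) (repr y)) by [].
rewrite rpre_cls; apply/rle_cls.
apply: ple_trans (pre_meet _ _ _).
have [h1 _] := repr_cls (peq_equiv _) (pre f (repr x)).
have [h2 _] := repr_cls (peq_equiv _) (pre f (repr y)).
have [h3 h4] := proj1 (ple_meet (repr (rpre f x)) (repr (rpre f y)) _) (ple_refl _).
by apply/ple_meet; split; [exact: ple_trans h3 h1|exact: ple_trans h4 h2].
Qed.

Lemma rpre_top {A B : C} (f : A ~> B) :
  rpre f (top : posetReflection (P B)) = top.
Proof.
apply: le_anti; first exact: le_top.
rewrite [X in rpre f X](_ : _ = cls peq ptop) // rpre_cls.
by apply/rle_cls; exact: pre_top.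
Qed.

Definition rreidx {A B : C} (f : A ~> B) :
    InfSlHom (posetReflection (P B)) (posetReflection (P A)) :=
  Build_InfSlHom (rpre_meet f) (rpre_top f).

Lemma rreidx_id (A : C) (x : posetReflection (P A)) : rreidx (idm A) x = x.
Proof.
by rewrite -[x in RHS]reprK; apply/(cls_eq (peq_equiv _)); exact: pre_id.
Qed.

Lemma rreidx_comp (A B D : C) (g : B ~> D) (f : A ~> B)
    (x : posetReflection (P D)) :
  rreidx (g ∘ f) x = rreidx f (rreidx g x).
Proof.
rewrite /= [in RHS]/rpre -/(rpre _ _) rpre_cls.
by apply/(cls_eq (peq_equiv _)); exact: pre_comp.
Qed.

Definition doctrineReflection : Doctrine C := Build_Doctrine rreidx_id rreidx_comp.

End DoctrineReflection.

Section WeakSubobjects.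
Context {D : Category} {L : FinLim D}.

Section Slice.
Variable A : D.

Definition slice : Type := {B : D & B ~> A}.

Definition slice_le (x y : slice) : Prop :=
  exists h : projT1 x ~> projT1 y, projT2 x = projT2 y ∘ h.

Definition slice_meet (x y : slice) : slice :=
  existT (fun B => B ~> A) (pb (projT2 x) (projT2 y))
    (projT2 x ∘ pb1 (projT2 x) (projT2 y)).

Definition slice_top : slice := existT (fun B => B ~> A) A (idm A).

Lemma slice_le_refl x : slice_le x x.
Proof. by exists (idm _); rewrite comp_idr. Qed.

Lemma slice_le_trans y x z : slice_le x y -> slice_le y z -> slice_le x z.
Proof. by case=> h e [k e']; exists (k ∘ h); rewrite compA -e'. Qed.

Lemma slice_le_meet x y z :
  slice_le z (slice_meet x y) <-> slice_le z x /\ slice_le z y.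
Proof.
split=> [[h /= e]|[[h eh] [k ek]]].
  split; [exists (pb1 _ _ ∘ h)|exists (pb2 _ _ ∘ h)]; rewrite e compA //.
  by rewrite pb_sq.
have e : projT2 x ∘ h = projT2 y ∘ k by rewrite -eh -ek.
by exists (pb_pair e); rewrite /= -compA pb_pair1.
Qed.

Lemma slice_le_top x : slice_le x slice_top.
Proof. by exists (projT2 x); rewrite /= comp_idl. Qed.

Definition sliceInfSl : PreInfSl :=
  Build_PreInfSl slice_le_refl slice_le_trans slice_le_meet slice_le_top.

End Slice.

Definition slice_pre {A B : D} (f : A ~> B) (x : sliceInfSl B) : sliceInfSl A :=
  existT (fun X => X ~> A) (pb f (projT2 x)) (pb1 f (projT2 x)).

Lemma slice_preP {A B : D} (f : A ~> B) (x : sliceInfSl B) (z : sliceInfSl A) :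
  ple z (slice_pre f x) <->
  exists h : projT1 z ~> projT1 x, f ∘ projT2 z = projT2 x ∘ h.
Proof.
split=> [[h /= ->]|[h e]].
  by exists (pb2 f (projT2 x) ∘ h); rewrite !compA pb_sq.
by exists (pb_pair e); rewrite /= pb_pair1.
Qed.

Definition weakSubobjectPre : PreDoctrine D.
Proof.
refine (@Build_PreDoctrine D sliceInfSl (@slice_pre) _ _ _ _ _).
- move=> A B f x y [h e]; apply/slice_preP.
  by exists (h ∘ pb2 _ _); rewrite /= pb_sq e compA.
- move=> A B f x y; apply/slice_preP.
  have [h1 h2] := proj1 (ple_meet (slice_pre f x) (slice_pre f y) _) (ple_refl _).
  case/slice_preP: h1 => u eu; case/slice_preP: h2 => v ev.
  have e : projT2 x ∘ u = projT2 y ∘ v by rewrite -eu -ev.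
  by exists (pb_pair e); rewrite eu /= -[in RHS]compA pb_pair1.
- by move=> A B f; apply/slice_preP; exists f; rewrite /= comp_idl comp_idr.
- move=> A x; split.
    by exists (pb2 _ _); rewrite /= -pb_sq comp_idl.
  by apply/slice_preP; exists (idm _); rewrite comp_idl comp_idr.
- move=> A B E g f x; split.
    apply/slice_preP; have e : g ∘ (f ∘ pb1 (g ∘ f) (projT2 x)) = projT2 x ∘ pb2 (g ∘ f) (projT2 x).
      by rewrite compA pb_sq.
    exists (pb_pair e).
    by rewrite /= pb_pair1.
  apply/slice_preP; exists (pb2 _ _ ∘ pb2 _ _).
  by rewrite /= -compA (pb_sq f) compA (pb_sq g) -compA.
Defined.

End WeakSubobjects.

Definition weakSubobject (D : Category) {L : FinLim D} : Doctrine D :=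
  doctrineReflection (@weakSubobjectPre D L).
Arguments weakSubobject D {L}.

Section ExistentialCompletion.
Context {C : Category} {L : FinLim C} (P : Doctrine C).

Section Fibre.
Variable A : C.

Record exElt := ExElt { ex_dom : C; ex_arr : ex_dom ~> A; ex_pred : P ex_dom }.

Definition ex_le (x y : exElt) : Prop :=
  exists h : ex_dom x ~> ex_dom y,
    ex_arr x = ex_arr y ∘ h /\ ex_pred x ≤ reidx P h (ex_pred y).

Definition ex_meet (x y : exElt) : exElt :=
  ExElt (ex_arr x ∘ pb1 (ex_arr x) (ex_arr y))
    (reidx P (pb1 (ex_arr x) (ex_arr y)) (ex_pred x)
       ⊓ reidx P (pb2 (ex_arr x) (ex_arr y)) (ex_pred y)).

Definition ex_top : exElt := ExElt (idm A) top.

Lemma ex_le_refl x : ex_le x x.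
Proof.
by exists (idm _); rewrite comp_idr reidx_id; split=> //; exact: le_refl.
Qed.

Lemma ex_le_trans y x z : ex_le x y -> ex_le y z -> ex_le x z.
Proof.
case=> h [e l] [k [e' l']]; exists (k ∘ h); split; first by rewrite compA -e'.
by rewrite reidx_comp; apply: le_trans l _; exact: hom_le.
Qed.

Lemma ex_le_meet x y z : ex_le z (ex_meet x y) <-> ex_le z x /\ ex_le z y.
Proof.
split=> [[h [/= e]]|[[h [eh lh]] [k [ek lk]]]].
  rewrite hom_meet -!reidx_comp => /le_meet [l1 l2].
  split; [exists (pb1 _ _ ∘ h)|exists (pb2 _ _ ∘ h)]; split=> //; rewrite e compA //.
  by rewrite pb_sq.
have e : ex_arr x ∘ h = ex_arr y ∘ k by rewrite -eh -ek.
exists (pb_pair e) => /=; split; first by rewrite -compA pb_pair1.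
by rewrite hom_meet -!reidx_comp pb_pair1 pb_pair2; apply/le_meet.
Qed.

Lemma ex_le_top x : ex_le x ex_top.
Proof.
by exists (ex_arr x); rewrite /= comp_idl hom_top; split=> //; exact: le_top.
Qed.

Definition exInfSl : PreInfSl :=
  Build_PreInfSl ex_le_refl ex_le_trans ex_le_meet ex_le_top.

End Fibre.

Definition ex_pre {A B : C} (f : A ~> B) (x : exInfSl B) : exInfSl A :=
  ExElt (pb1 f (ex_arr x)) (reidx P (pb2 f (ex_arr x)) (ex_pred x)).

Lemma ex_preP {A B : C} (f : A ~> B) (x : exInfSl B) (z : exInfSl A) :
  ple z (ex_pre f x) <->
  exists h : ex_dom z ~> ex_dom x,
    f ∘ ex_arr z = ex_arr x ∘ h /\ ex_pred z ≤ reidx P h (ex_pred x).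
Proof.
split=> [[h /= [-> l]]|[h [e l]]].
  exists (pb2 f (ex_arr x) ∘ h); split; first by rewrite !compA pb_sq.
  by rewrite reidx_comp.
by exists (pb_pair e); rewrite /= pb_pair1 -reidx_comp pb_pair2.
Qed.

Definition existentialCompletionPre : PreDoctrine C.
Proof.
refine (@Build_PreDoctrine C exInfSl (@ex_pre) _ _ _ _ _).
- move=> A B f x y [h [e l]]; apply/ex_preP.
  exists (h ∘ pb2 _ _); rewrite /= pb_sq e compA; split=> //.
  by rewrite reidx_comp; exact: hom_le.
- move=> A B f x y; apply/ex_preP.
  have [h1 h2] := proj1 (ple_meet (ex_pre f x) (ex_pre f y) _) (ple_refl _).
  case/ex_preP: h1 => u [eu lu]; case/ex_preP: h2 => v [ev lv].
  have e : ex_arr x ∘ u = ex_arr y ∘ v by rewrite -eu -ev.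
  exists (pb_pair e); split; first by rewrite eu /= -[in RHS]compA pb_pair1.
  by rewrite [ex_pred (pmeet x y)]/= hom_meet -!reidx_comp pb_pair1 pb_pair2; apply/le_meet.
- move=> A B f; apply/ex_preP; exists f; rewrite /= comp_idl comp_idr hom_top.
  by split=> //; exact: le_refl.
- move=> A x; split.
    by exists (pb2 _ _); rewrite /= -pb_sq comp_idl; split=> //; exact: le_refl.
  apply/ex_preP; exists (idm _); rewrite comp_idl comp_idr reidx_id.
  by split=> //; exact: le_refl.
- move=> A B E g f x; split.
    apply/ex_preP; have e : g ∘ (f ∘ pb1 (g ∘ f) (ex_arr x)) = ex_arr x ∘ pb2 (g ∘ f) (ex_arr x).
      by rewrite compA pb_sq.
    exists (pb_pair e).
    by rewrite /= pb_pair1 -reidx_comp pb_pair2; split=> //; exact: le_refl.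
  apply/ex_preP; exists (pb2 _ _ ∘ pb2 _ _); split.
    by rewrite /= -compA (pb_sq f) compA (pb_sq g) -compA.
  by rewrite reidx_comp; exact: le_refl.
Defined.

Definition existentialCompletion : Doctrine C :=
  doctrineReflection existentialCompletionPre.

End ExistentialCompletion.

Section Points.
Context {C : Category} (P : Doctrine C).

Record point := Point { pt_ob : C; pt_pred : P pt_ob }.

Definition pointHom (X Y : point) : Type :=
  {f : pt_ob X ~> pt_ob Y | pt_pred X ≤ reidx P f (pt_pred Y)}.

Definition mk_pointHom {X Y : point} (f : pt_ob X ~> pt_ob Y)
  (h : pt_pred X ≤ reidx P f (pt_pred Y)) : pointHom X Y := exist _ f h.

Lemma point_id_proof (X : point) : pt_pred X ≤ reidx P (idm (pt_ob X)) (pt_pred X).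
Proof. by rewrite reidx_id; exact: le_refl. Qed.

Lemma point_comp_proof (X Y Z : point) (g : pointHom Y Z) (f : pointHom X Y) :
  pt_pred X ≤ reidx P (proj1_sig g ∘ proj1_sig f) (pt_pred Z).
Proof.
case: f g => [f hf] [g hg] /=; rewrite reidx_comp.
by apply: le_trans hf _; exact: hom_le.
Qed.

Definition point_id (X : point) : pointHom X X :=
  mk_pointHom (point_id_proof X).
Definition point_comp (X Y Z : point) (g : pointHom Y Z) (f : pointHom X Y) :
  pointHom X Z := mk_pointHom (point_comp_proof g f).

Definition points : Category.
Proof.
refine (@Build_Category point pointHom point_id point_comp _ _ _).
- by move=> X Y f; apply: sig_eq; exact: comp_idl.
- by move=> X Y f; apply: sig_eq; exact: comp_idr.
- by move=> X Y Z W h g f; apply: sig_eq; exact: compA.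
Defined.

Context {L : FinLim C}.

Definition point_one : points := Point (top : P one).

Lemma point_oneP : IsTerminal point_one.
Proof.
move=> X; have h : pt_pred X ≤ reidx P (bang (pt_ob X)) (pt_pred point_one).
  by rewrite hom_top; exact: le_top.
exists (mk_pointHom h); split=> // g _.
by apply: sig_eq; exact: bang_uniq.
Qed.

Section PointPullback.
Context {X Y Z : points} (f : X ~> Z) (g : Y ~> Z).

Definition point_pb : points :=
  Point (reidx P (pb1 (proj1_sig f) (proj1_sig g)) (pt_pred X)
     ⊓ reidx P (pb2 (proj1_sig f) (proj1_sig g)) (pt_pred Y)).

Definition point_pb1 : point_pb ~> X :=
  mk_pointHom (X := point_pb) (f := pb1 (proj1_sig f) (proj1_sig g)) (meet_lel _ _).

Definition point_pb2 : point_pb ~> Y :=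
  mk_pointHom (X := point_pb) (f := pb2 (proj1_sig f) (proj1_sig g)) (meet_ler _ _).

Lemma point_pbP : IsPullback f g point_pb1 point_pb2.
Proof.
split; first by apply: sig_eq; exact: pb_sq.
move=> W a b /(f_equal (@proj1_sig _ _)) /= e.
have h : pt_pred W ≤ reidx P (pb_pair e) (pt_pred point_pb).
  rewrite hom_meet -!reidx_comp pb_pair1 pb_pair2; apply/le_meet.
  by split; [exact: (proj2_sig a)|exact: (proj2_sig b)].
exists (mk_pointHom h); split.
  by split; apply: sig_eq; [exact: pb_pair1|exact: pb_pair2].
move=> k [/(f_equal (@proj1_sig _ _)) /= e1 /(f_equal (@proj1_sig _ _)) /= e2].
by apply: sig_eq; apply: pb_ext; rewrite ?pb_pair1 ?pb_pair2.
Qed.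

End PointPullback.

#[global] Instance pointsFinLim : FinLim points :=
  {| one := point_one; oneP := point_oneP;
     pb := @point_pb; pb1 := @point_pb1; pb2 := @point_pb2; pbP := @point_pbP |}.

End Points.

Section WeakDependentProducts.
Context {D : Category} {L : FinLim D}.

Lemma pb_induced_sq {J I Z Z' : D} (g : J ~> I) {h : Z ~> I} {h' : Z' ~> I}
    {w : Z' ~> Z} (e : h' = h ∘ w) : g ∘ pb1 g h' = h ∘ (w ∘ pb2 g h').
Proof. by rewrite pb_sq compA e. Qed.

Definition pb_induced {J I Z Z' : D} (g : J ~> I) {h : Z ~> I} {h' : Z' ~> I}
    {w : Z' ~> Z} (e : h' = h ∘ w) : pb g h' ~> pb g h :=
  pb_pair (pb_induced_sq g e).

Definition IsWeakDependentProduct {X J I Z : D} (f : X ~> J) (g : J ~> I)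
    (h : Z ~> I) (ev : pb g h ~> X) : Prop :=
  f ∘ ev = pb1 g h /\
  forall (Z' : D) (h' : Z' ~> I) (ev' : pb g h' ~> X), f ∘ ev' = pb1 g h' ->
    exists (w : Z' ~> Z) (e : h' = h ∘ w), ev' = ev ∘ pb_induced g e.

Definition HasWeakDependentProducts : Prop :=
  forall (X J I : D) (f : X ~> J) (g : J ~> I),
  exists (Z : D) (h : Z ~> I) (ev : pb g h ~> X), IsWeakDependentProduct f ev.

Definition IsGenericProof {Theta Lambda : D} (theta : Theta ~> Lambda) : Prop :=
  forall (Y X : D) (f : Y ~> X), exists v : X ~> Lambda,
    (exists a : Y ~> pb v theta, f = pb1 v theta ∘ a) /\
    (exists b : pb v theta ~> Y, pb1 v theta = f ∘ b).

Definition HasGenericProof : Prop :=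
  exists (Theta Lambda : D) (theta : Theta ~> Lambda), IsGenericProof theta.

End WeakDependentProducts.

Arguments HasWeakDependentProducts D {L}.
Arguments HasGenericProof D {L}.

Definition ExSupercompactifiable {C : Category} {L : FinLim C}
    (P : Doctrine C) : Prop :=
  HasWeakDependentProducts (points P) /\ HasGenericProof (points P).

Section ExLex.
Context {D : Category} {L : FinLim D}.

(* [exLex] below is Carboni's explicit construction of the free exact category
   on [D]: pseudo-equivalence relations in [D], and arrows up to homotopy. *)
Record PseudoEqRel := {
  per_ob : D;
  per_rel : D;
  per_src : per_rel ~> per_ob;
  per_tgt : per_rel ~> per_ob;
  per_refl : exists r : per_ob ~> per_rel,
    per_src ∘ r = idm per_ob /\ per_tgt ∘ r = idm per_ob;
  per_sym : exists s : per_rel ~> per_rel,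
    per_src ∘ s = per_tgt /\ per_tgt ∘ s = per_src;
  per_trans : exists t : pb per_tgt per_src ~> per_rel,
    per_src ∘ t = per_src ∘ pb1 per_tgt per_src /\
    per_tgt ∘ t = per_tgt ∘ pb2 per_tgt per_src
}.

(* Arrows before passing to the quotient; the tracking arrow between the
   relations is required to exist but is not part of the data. *)
Definition perArr (X Y : PseudoEqRel) : Type :=
  {f : per_ob X ~> per_ob Y |
    exists f1 : per_rel X ~> per_rel Y,
      per_src Y ∘ f1 = f ∘ per_src X /\ per_tgt Y ∘ f1 = f ∘ per_tgt X}.

Definition perArr_eq {X Y : PseudoEqRel} (f g : perArr X Y) : Prop :=
  exists h : per_ob X ~> per_rel Y,
    per_src Y ∘ h = proj1_sig f /\ per_tgt Y ∘ h = proj1_sig g.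

Lemma perArr_equiv (X Y : PseudoEqRel) : Equivalence (@perArr_eq X Y).
Proof.
split=> [f|f g|f g k].
- have [r [e1 e2]] := per_refl Y; exists (r ∘ proj1_sig f).
  by rewrite !compA e1 e2 comp_idl.
- case=> h [e1 e2]; have [s [s1 s2]] := per_sym Y; exists (s ∘ h).
  by rewrite !compA s1 s2.
- case=> h [e1 e2] [h' [e1' e2']]; have [t [t1 t2]] := per_trans Y.
  have e : per_tgt Y ∘ h = per_src Y ∘ h' by rewrite e2 e1'.
  exists (t ∘ pb_pair e).
  by rewrite !compA t1 t2 -!compA pb_pair1 pb_pair2.
Qed.

Definition perArr_id (X : PseudoEqRel) : perArr X X.
Proof.
by exists (idm _), (idm _); rewrite !comp_idl !comp_idr.
Defined.

Definition perArr_comp {X Y Z : PseudoEqRel} (g : perArr Y Z) (f : perArr X Y) :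
  perArr X Z.
Proof.
exists (proj1_sig g ∘ proj1_sig f).
case: f g => [f [f1 [e1 e2]]] [g [g1 [e1' e2']]]; exists (g1 ∘ f1).
by rewrite /= !compA e1' e2' -!compA e1 e2.
Defined.

Lemma perArr_comp_eq {X Y Z : PseudoEqRel} (g g' : perArr Y Z) (f f' : perArr X Y) :
  perArr_eq g g' -> perArr_eq f f' ->
  perArr_eq (perArr_comp g f) (perArr_comp g' f').
Proof.
move=> [h [e1 e2]] [k [e1' e2']].
have tr := @Equivalence_Transitive _ _ (perArr_equiv X Z).
apply: (tr _ (perArr_comp g f')).
  case: (g) => [g0 [g1 [e e']]]; exists (g1 ∘ k).
  by rewrite /= !compA e e' -!compA e1' e2'.
by exists (h ∘ proj1_sig f'); rewrite /= !compA e1 e2.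
Qed.

Definition exLexHom (X Y : PseudoEqRel) : Type := quot (@perArr_eq X Y).

Definition exLex_comp {X Y Z : PseudoEqRel} (g : exLexHom Y Z) (f : exLexHom X Y) :
  exLexHom X Z := cls perArr_eq (perArr_comp (repr g) (repr f)).

Lemma exLex_comp_cls {X Y Z : PseudoEqRel} (g : perArr Y Z) (f : perArr X Y) :
  exLex_comp (cls perArr_eq g) (cls perArr_eq f) = cls perArr_eq (perArr_comp g f).
Proof.
apply/(cls_eq (perArr_equiv _ _)).
by apply: perArr_comp_eq; exact: (repr_cls (perArr_equiv _ _)).
Qed.

Definition exLex : Category.
Proof.
refine (@Build_Category PseudoEqRel exLexHom
  (fun X => cls perArr_eq (perArr_id X)) (@exLex_comp) _ _ _).
- move=> X Y f; rewrite -(reprK f) exLex_comp_cls; congr (cls _ _).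
  by apply: sig_eq; exact: comp_idl.
- move=> X Y f; rewrite -(reprK f) exLex_comp_cls; congr (cls _ _).
  by apply: sig_eq; exact: comp_idr.
- move=> X Y Z W h g f; rewrite -(reprK h) -(reprK g) -(reprK f) !exLex_comp_cls.
  by congr (cls _ _); apply: sig_eq; exact: compA.
Defined.

End ExLex.

Arguments exLex D {L}.

Section Topos.
Context {E : Category} {L : FinLim E}.

Definition HasExponentials : Prop :=
  forall A B : E, exists (BA : E) (ev : prod BA A ~> B),
  forall (X : E) (f : prod X A ~> B),
    exists! g : X ~> BA, ev ∘ prod_map g (idm A) = f.

Definition HasSubobjectClassifier : Prop :=
  exists (Omega : E) (true_ : one ~> Omega),
  forall (U X : E) (m : U ~> X), IsMono m ->
    exists! chi : X ~> Omega, IsPullback chi true_ m (bang U).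

End Topos.

Arguments HasExponentials E {L}.
Arguments HasSubobjectClassifier E {L}.

Definition IsTopos (E : Category) : Prop :=
  exists L : FinLim E, HasExponentials E /\ HasSubobjectClassifier E.

Definition exactPoints {C : Category} {L : FinLim C} (P : Doctrine C) : Category :=
  exLex (points P).

(* Main.v *)
From Corelib Require Import ssreflect ssrfun ssrbool.
From Stdlib Require Import RelationClasses Setoid Morphisms IndefiniteDescription.
Require Import Defs.

Set Implicit Arguments.
Unset Strict Implicit.
Unset Printing Implicit Defensive.

(* For a finite-limit category [D], all the conditions reduce to one about generalized
   elements: universal quantification along arrows of [D], where an arrow into [A]
   is read as the predicate of factoring through it ([has_universals]), and weak power
   objects ([has_weak_powers]).

   A weak dependent product is carved out of a weak power object by a universal
   quantifier.  In a doctrine with existential quantifiers, right adjoints to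
   reindexing automatically satisfy Beck-Chevalley and preserve the Heyting structure,
   and joins are encoded impredicatively.  The fibre of the existential completion
   over [A] is the fibre of the weak subobjects of the category of points over
   [(A, top)], and the fibre over [(A, a)] is a down-set of it.  In the exact
   completion, exponentials and the subobject classifier are subquotients of weak
   exponentials and of the base of a generic proof; conversely, every object is covered
   by a projective object coming from [D], and subobjects of such an object are its weak
   subobjects, so that weak power objects in [D] are covers of power objects. *)

(** * Generalized elements and weak dependent products *)

Section GeneralizedElements.
Context {D : Category}.

(** The order of the slice over [A], read as membership: [a] is a generalized element of the
    predicate [f]. *)
Definition factors {A B C : D} (f : B ~> A) (a : C ~> A) : Prop :=
  exists u : C ~> B, a = f ∘ u.

(** Membership in a relation given as a span, which makes sense without products. *)
Definition factors2 {A B R C : D} (s : R ~> A) (t : R ~> B)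
    (a : C ~> A) (b : C ~> B) : Prop :=
  exists u : C ~> R, a = s ∘ u /\ b = t ∘ u.

Definition representable {A : D} (Φ : forall C : D, C ~> A -> Prop) : Prop :=
  exists (R : D) (r : R ~> A), forall (C : D) (a : C ~> A), factors r a <-> Φ C a.

Lemma factors_id {A B : D} (f : B ~> A) : factors f f.
Proof. by exists (idm _); rewrite comp_idr. Qed.

Lemma factors_idm {A C : D} (a : C ~> A) : factors (idm A) a.
Proof. by exists a; rewrite comp_idl. Qed.

Lemma factors_comp {A B C C' : D} (f : B ~> A) (a : C ~> A) (k : C' ~> C) :
  factors f a -> factors f (a ∘ k).
Proof. by case=> u ->; exists (u ∘ k); rewrite compA. Qed.

Lemma factors_trans {A B B' C : D} (f : B ~> A) (g : B' ~> A) (a : C ~> A) :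
  factors g f -> factors f a -> factors g a.
Proof. by case=> v -> [u ->]; exists (v ∘ u); rewrite compA. Qed.

Lemma factors2_id {A B R : D} (s : R ~> A) (t : R ~> B) : factors2 s t s t.
Proof. by exists (idm _); rewrite !comp_idr. Qed.

Lemma factors2_comp {A B R C C' : D} (s : R ~> A) (t : R ~> B)
    (a : C ~> A) (b : C ~> B) (k : C' ~> C) :
  factors2 s t a b -> factors2 s t (a ∘ k) (b ∘ k).
Proof. by case=> u [-> ->]; exists (u ∘ k); rewrite !compA. Qed.

(** The forcing clause for the universal quantifier along [g]: [k] passes to a later stage, where
    [j] is any element of the fibre over [a]. *)
Definition has_universals : Prop :=
  forall (X J I : D) (f : X ~> J) (g : J ~> I),
  representable (fun C (a : C ~> I) => forall (C' : D) (k : C' ~> C) (j : C' ~> J),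
    g ∘ j = a ∘ k -> factors f j).

(** Weak power objects in elementwise form: neither is [chi] unique nor is the membership span
    jointly monic in general. *)
Definition has_weak_powers : Prop :=
  forall X : D, exists (PX M : D) (m1 : M ~> X) (m2 : M ~> PX),
  forall (Y B : D) (b1 : B ~> X) (b2 : B ~> Y), exists chi : Y ~> PX,
  forall (C : D) (x : C ~> X) (y : C ~> Y),
    factors2 b1 b2 x y <-> factors2 m1 m2 x (chi ∘ y).

Definition is_generic {Theta Lambda : D} (theta : Theta ~> Lambda) : Prop :=
  forall (Y X : D) (f : Y ~> X), exists v : X ~> Lambda,
  forall (C : D) (x : C ~> X), factors f x <-> factors theta (v ∘ x).

End GeneralizedElements.

(** * Representable predicates and their closure under logical operations *)

Section FiniteLimitCategory.
Context {D : Category} {L : FinLim D}.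

Lemma fst_pair {X A B : D} (a : X ~> A) (b : X ~> B) : fst ∘ pair a b = a.
Proof. exact: pb_pair1. Qed.

Lemma snd_pair {X A B : D} (a : X ~> A) (b : X ~> B) : snd ∘ pair a b = b.
Proof. exact: pb_pair2. Qed.

Lemma prod_ext {X A B : D} (u v : X ~> prod A B) :
  fst ∘ u = fst ∘ v -> snd ∘ u = snd ∘ v -> u = v.
Proof. exact: pb_ext. Qed.

Lemma pair_comp {X Y A B : D} (a : X ~> A) (b : X ~> B) (k : Y ~> X) :
  pair a b ∘ k = pair (a ∘ k) (b ∘ k).
Proof. by apply: prod_ext; rewrite compA ?fst_pair ?snd_pair. Qed.

Lemma pair_eta {X A B : D} (c : X ~> prod A B) : pair (fst ∘ c) (snd ∘ c) = c.
Proof. by apply: prod_ext; rewrite ?fst_pair ?snd_pair. Qed.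

Lemma prod_map_pair {X A A' B B' : D} (f : A ~> A') (g : B ~> B')
    (a : X ~> A) (b : X ~> B) :
  prod_map f g ∘ pair a b = pair (f ∘ a) (g ∘ b).
Proof. by rewrite /prod_map pair_comp -!compA fst_pair snd_pair. Qed.

Lemma pair_inj {X A B : D} (a a' : X ~> A) (b b' : X ~> B) :
  pair a b = pair a' b' -> a = a' /\ b = b'.
Proof.
move=> e; split; first by rewrite -(fst_pair a b) e fst_pair.
by rewrite -(snd_pair a b) e snd_pair.
Qed.

Lemma factors_pair {A B R C : D} (s : R ~> A) (t : R ~> B) (a : C ~> A) (b : C ~> B) :
  factors (pair s t) (pair a b) <-> factors2 s t a b.
Proof.
split=> [[u]|[u [-> ->]]]; first by rewrite pair_comp => /pair_inj [e1 e2]; exists u.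
by exists u; rewrite pair_comp.
Qed.

Lemma factors_pb1 {A B I C : D} (f : A ~> I) (g : B ~> I) (a : C ~> A) :
  factors (pb1 f g) a <-> factors g (f ∘ a).
Proof.
split=> [[u ->]|[v e]]; first by exists (pb2 f g ∘ u); rewrite !compA pb_sq.
by exists (pb_pair e); rewrite pb_pair1.
Qed.

Lemma representable_ext {A : D} (Φ Ψ : forall C : D, C ~> A -> Prop) :
  (forall C a, Φ C a <-> Ψ C a) -> representable Φ -> representable Ψ.
Proof.
by move=> e [R [r h]]; exists R, r => C a; rewrite h; exact: e.
Qed.

Lemma representable_factors {A B : D} (f : B ~> A) :
  representable (fun C (a : C ~> A) => factors f a).
Proof. by exists B, f. Qed.

Lemma representable_comp {A B : D} (f : A ~> B) (Φ : forall C : D, C ~> B -> Prop) :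
  representable Φ -> representable (fun C (a : C ~> A) => Φ C (f ∘ a)).
Proof.
by case=> R [r h]; exists _, (pb1 f r) => C a; rewrite factors_pb1.
Qed.

Lemma representable_and {A : D} (Φ Ψ : forall C : D, C ~> A -> Prop) :
  representable Φ -> representable Ψ ->
  representable (fun C (a : C ~> A) => Φ C a /\ Ψ C a).
Proof.
case=> R [r h] [S [s k]]; exists _, (r ∘ pb1 r s) => C a; rewrite -h -k.
split=> [[u ->]|[[u eu] [v ev]]].
  split; first by exists (pb1 r s ∘ u); rewrite compA.
  by exists (pb2 r s ∘ u); rewrite pb_sq compA.
have e : r ∘ u = s ∘ v by rewrite -eu -ev.
by exists (pb_pair e); rewrite -compA pb_pair1.
Qed.

Lemma representable_eq {A B : D} (u v : A ~> B) :
  representable (fun C (a : C ~> A) => u ∘ a = v ∘ a).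
Proof.
exists _, (pb1 (pair u v) (pair (idm B) (idm B))) => C a; rewrite factors_pb1.
split=> [[w]|e].
  by rewrite !pair_comp comp_idl => /pair_inj [-> ->].
by exists (u ∘ a); rewrite !pair_comp comp_idl e.
Qed.

(* Existentials are composites, so their witnesses are always global. *)
Lemma representable_exists {A B : D} (Φ : forall C : D, C ~> prod A B -> Prop) :
  representable Φ ->
  representable (fun C (a : C ~> A) => exists b : C ~> B, Φ C (pair a b)).
Proof.
case=> R [r h]; exists R, (fst ∘ r) => C a.
split=> [[u ->]|[b /h [u e]]].
  exists (snd ∘ r ∘ u); apply/h; exists u.
  by rewrite -!compA pair_eta.
by exists u; rewrite -compA -e fst_pair.
Qed.

Section WithUniversals.
Hypothesis univ : @has_universals D.

Lemma representable_forall_along {J I : D} (g : J ~> I)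
    (Φ : forall C : D, C ~> J -> Prop) :
  representable Φ ->
  representable (fun C (a : C ~> I) =>
    forall (C' : D) (k : C' ~> C) (j : C' ~> J), g ∘ j = a ∘ k -> Φ C' j).
Proof.
case=> R [r h]; apply: representable_ext (univ r g) => C a.
by split=> H C' k j e; apply/h; apply: H e.
Qed.

Lemma representable_forall {A B : D} (Φ : forall C : D, C ~> prod A B -> Prop) :
  representable Φ ->
  representable (fun C (a : C ~> A) =>
    forall (C' : D) (k : C' ~> C) (b : C' ~> B), Φ C' (pair (a ∘ k) b)).
Proof.
move/(representable_forall_along fst); apply: representable_ext => C a.
split=> [H C' k b|H C' k j e]; first by apply: (H C' k); rewrite fst_pair.
by rewrite -(pair_eta j) e.
Qed.

(** Implication is quantification along the arrow [r] representing the premise, applied to the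
    pullback of [s] along [r]. *)
Lemma representable_imp {A : D} (Φ Ψ : forall C : D, C ~> A -> Prop) :
  representable Φ -> representable Ψ ->
  representable (fun C (a : C ~> A) =>
    forall (C' : D) (k : C' ~> C), Φ C' (a ∘ k) -> Ψ C' (a ∘ k)).
Proof.
case=> R [r h] [S [s k]].
apply: representable_ext (univ (pb1 r s) r) => C a.
split=> [H C' l /h [u e]|H C' l j e].
  by apply/k; rewrite e -factors_pb1; apply: (H C' l).
rewrite factors_pb1 e; apply/k/H/h; exists j; exact: esym.
Qed.

End WithUniversals.
End FiniteLimitCategory.

(** * Weak dependent products and generic proofs in terms of generalized elements *)

Section WeakDependentProducts.
Context {D : Category} {L : FinLim D}.

Lemma has_generic_proofP :
  HasGenericProof D <->
  exists (Theta Lambda : D) (theta : Theta ~> Lambda), is_generic theta.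
Proof.
split=> [] [T [Λ [θ h]]]; exists T, Λ, θ => Y X f.
  have [v [ha hb]] := h Y X f; exists v => C x; rewrite -factors_pb1.
  split; [exact: factors_trans ha|exact: factors_trans hb].
have [v hv] := h Y X f; exists v; split; first by apply/factors_pb1/hv/factors_id.
by apply/hv/factors_pb1/factors_id.
Qed.

Lemma wdp_universals : HasWeakDependentProducts D -> @has_universals D.
Proof.
move=> wdp X J I f g; have [Z [h [ev [e u]]]] := wdp X J I f g.
exists Z, h => C a; split=> [[w ->] C' k j ej|H].
  rewrite -compA in ej; exists (ev ∘ pb_pair ej).
  by rewrite compA e pb_pair1.
(* The hypothesis at the universal fibre element is an evaluation over [a]; weak universality then
   factors [a] through [h]. *)
have [ev' e'] := H _ (pb2 g a) (pb1 g a) (pb_sq g a).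
by have [w [ew _]] := u _ a ev' (esym e'); exists w.
Qed.

(** A weak exponential is a weak dependent product of the projection from [prod X Y] to [X] along
    the arrow from [X] to [one]. *)
Lemma wdp_weak_exponentials (X Y : D) : HasWeakDependentProducts D ->
  exists (W : D) (ev : prod W X ~> Y),
  forall (T : D) (f : prod T X ~> Y), exists w : T ~> W,
  forall (C : D) (t : C ~> T) (x : C ~> X), f ∘ pair t x = ev ∘ pair (w ∘ t) x.
Proof.
move=> wdp.
have [Z [h [ev [e u]]]] := wdp (prod X Y) X one fst (bang X).
have sq (T : D) (k : T ~> one) C (t : C ~> T) (x : C ~> X) : bang X ∘ x = k ∘ t.
  exact: bang_uniq.
exists Z, (snd ∘ ev ∘ pb_pair (sq _ h _ fst snd)) => T f.
have [w [ew ee]] := u T (bang T) (pair (pb1 _ _) (f ∘ pair (pb2 _ _) (pb1 _ _)))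
  (fst_pair _ _).
exists w => C t x.
have := f_equal (fun z => snd ∘ z ∘ pb_pair (sq _ (bang T) _ t x)) ee.
rewrite snd_pair -compA pair_comp pb_pair1 pb_pair2 => ->.
rewrite -!compA; do 2 congr (_ ∘ _); apply: pb_ext.
  by rewrite !compA !pb_pair1 snd_pair.
by rewrite !compA !pb_pair2 -!compA fst_pair pb_pair2.
Qed.

(** The weak power object is a weak exponential of the base [Λ] of a generic proof, with membership
    the pullback of [θ] along evaluation. *)
Lemma wdp_weak_powers :
  HasWeakDependentProducts D -> HasGenericProof D -> @has_weak_powers D.
Proof.
move=> wdp /has_generic_proofP [T [Λ [θ gen]]] X.
have [W [ev u]] := wdp_weak_exponentials X Λ wdp.
exists W, (pb ev θ), (snd ∘ pb1 ev θ), (fst ∘ pb1 ev θ) => Y B b1 b2.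
have [v hv] := gen _ _ (pair b2 b1); have [w hw] := u Y v.
exists w => C x y.
have -> : factors2 b1 b2 x y <-> factors (pair b2 b1) (pair y x).
  by rewrite factors_pair; split=> [] [z []]; exists z.
rewrite hv hw -factors_pb1.
split=> [[z e]|[z [-> e]]].
  by exists z; rewrite -!compA -e fst_pair snd_pair.
by exists z; rewrite e -!compA pair_eta.
Qed.

(** A relation between [one] and [X] is a predicate on [X], so membership for the weak power object
    of [one] is a generic proof. *)
Lemma weak_powers_generic : @has_weak_powers D -> HasGenericProof D.
Proof.
move/(_ one) => [Λ [T [m1 [θ h]]]]; apply/has_generic_proofP; exists T, Λ, θ.
move=> Y X f; have [v hv] := h X Y (bang Y) f; exists v => C x.
have {hv} := hv C (bang C) x.
have aux (R A : D) (s : R ~> one) (t : R ~> A) a :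
    factors2 s t (bang C) a <-> factors t a.
  by split=> [] [u]; [case|] => *; exists u => //; split=> //; exact: bang_uniq.
by rewrite !aux.
Qed.

(* The carrier is the object of pairs [(i, s)] such that [s] meets every fibre
   of [f] over [g^-1 i].  An [s] coming from the graph of a choice [ev'] has only
   one element over each point of the pullback, so that the evaluation recovers
   [ev'] on the nose and not merely its domain. *)
Lemma universals_wdp :
  @has_universals D -> @has_weak_powers D -> HasWeakDependentProducts D.
Proof.
move=> univ wp X J I f g; have [PX [M [m1 [m2 hm]]]] := wp X.
have [Z [z hz]] := univ _ _ _ (pair (f ∘ m1) m2) (prod_map g (idm PX)).
have sq : g ∘ pb1 g (fst ∘ z) = fst ∘ z ∘ pb2 g (fst ∘ z) by exact: pb_sq.
have [v ev] : factors (pair (f ∘ m1) m2)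
    (pair (pb1 g (fst ∘ z)) (snd ∘ z ∘ pb2 g (fst ∘ z))).
  apply: (proj1 (hz _ z) (factors_id z) _ (pb2 g (fst ∘ z))).
  by rewrite prod_map_pair comp_idl sq -!compA pair_eta.
move: ev; rewrite pair_comp => /pair_inj [e1 e2].
exists Z, (fst ∘ z), (m1 ∘ v); split; first by rewrite compA.
move=> Z' h' ev' e'.
have [chi hchi] := hm _ _ ev' (pb2 g h').
(* [chi] names the graph of [ev'], which meets every fibre because [ev'] is defined on the whole
   pullback. *)
have [w ew] : factors z (pair h' chi).
  apply/hz => C k j; rewrite pair_comp -(pair_eta j) prod_map_pair comp_idl.
  move/pair_inj => [sqj ->]; apply/factors_pair.
  have : factors2 ev' (pb2 g h') (ev' ∘ pb_pair sqj) k.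
    by exists (pb_pair sqj); rewrite pb_pair2.
  move/hchi=> [u [eu ->]]; exists u; split=> //.
  by rewrite -compA -eu compA e' pb_pair1.
have ew1 : h' = fst ∘ z ∘ w by rewrite -compA -ew fst_pair.
have ew2 : chi = snd ∘ z ∘ w by rewrite -compA -ew snd_pair.
exists w, ew1.
set κ := pb_induced g ew1.
have κ1 : pb1 g (fst ∘ z) ∘ κ = pb1 g h' by exact: pb_pair1.
have κ2 : pb2 g (fst ∘ z) ∘ κ = w ∘ pb2 g h' by exact: pb_pair2.
have : factors2 m1 m2 (m1 ∘ v ∘ κ) (chi ∘ pb2 g h').
  exists (v ∘ κ); rewrite !compA; split=> //.
  by rewrite -e2 -compA κ2 ew2 !compA.
move/hchi=> [u [eu1 eu2]].
(* [u] is the point of the pullback at which [ev'] takes the value given by evaluation; its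
   projections are those of the identity. *)
suff eu : u = idm _ by rewrite eu1 eu comp_idr.
apply: pb_ext; rewrite comp_idr; last exact: esym eu2.
by rewrite -{1}e' -compA -eu1 !compA -e1.
Qed.

Lemma wdp_genericP :
  HasWeakDependentProducts D /\ HasGenericProof D <->
  @has_universals D /\ @has_weak_powers D.
Proof.
split=> [[wdp gen]|[univ wp]].
  by split; [exact: wdp_universals|exact: wdp_weak_powers].
by split; [exact: universals_wdp|exact: weak_powers_generic].
Qed.

End WeakDependentProducts.

(** * Weak subobjects as a tripos *)

Section FirstOrderDoctrines.
Context {C : Category} (Q : Doctrine C).

(* Stability of implication and Beck-Chevalley for the universal quantifiers are
   the mates of Frobenius and of Beck-Chevalley for the existential ones, and a
   reindexing with a right adjoint preserves joins. *)
Lemma full_first_order_of_adjoints :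
  FullExistential Q -> (forall A : C, inhabited (Heyting (Q A))) ->
  (exists all : forall A B : C, A ~> B -> Q A -> Q B,
    forall (A B : C) (f : A ~> B) (x : Q A) (y : Q B),
      reidx Q f y ≤ x <-> y ≤ all A B f x) ->
  FullFirstOrder Q.
Proof.
move=> exQ hey [all adj]; have [ex [exadj bc frob]] := exQ; split=> //.
(* The structure is chosen fibre by fibre; compatibility with reindexing follows because the order
   determines the operations. *)
- have h A : Heyting (Q A).
    exact: (proj1_sig (constructive_indefinite_description (fun _ => True)
      (let: inhabits k := hey A in ex_intro _ k I))).
  exists h => A B f; split=> [|x y|x y].
  + by apply: le_anti; [apply/adj|]; exact: le_bot.
  + have [l1 l2] := proj1 (le_join (h A) _ _ _) (le_refl (join (h A) (reidx Q f x) (reidx Q f y))).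
    have [l3 l4] := proj1 (le_join (h B) _ _ _) (le_refl (join (h B) x y)).
    apply: le_anti; last by apply/le_join; split; exact: hom_le.
    by apply/adj/le_join; split; apply/adj.
  + apply: le_anti.
      by apply/le_imp; rewrite -hom_meet; apply: hom_le; apply/le_imp; exact: le_refl.
    apply/exadj/le_imp; rewrite -frob; apply/exadj/le_imp; exact: le_refl.
- exists all; split=> // A B D X f g p q [e u] x.
  (* Taking mates transposes the square: Beck-Chevalley for [all] along [f] comes from that for [ex]
     along [g]. *)
  have pb' : IsPullback g f q p.
    split=> [|Y b a e']; first exact: esym.
    have [k [[k1 k2] ku]] := u Y a b (esym e').
    by exists k; split=> // k' [? ?]; apply: ku.
  have adjl y : y ≤ reidx Q g (all A D f x) <-> y ≤ all X B q (reidx Q p x).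
    by rewrite -exadj -!adj -exadj (bc _ _ _ _ _ _ _ _ pb').
  by apply: le_anti; [rewrite -adjl|rewrite adjl]; exact: le_refl.
Qed.

End FirstOrderDoctrines.

(** * First-order structure on preorders and its passage to the poset reflection *)

Section PreDoctrines.
Context {C : Category} (R : PreDoctrine C).

(** Of Beck-Chevalley and Frobenius only the inequalities that the adjunction does not already give
    are recorded. *)
Definition pre_existential : Prop :=
  exists ex : forall A B : C, A ~> B -> R A -> R B,
  [/\ (forall (A B : C) (f : A ~> B) (x : R A) (y : R B),
         ple (ex A B f x) y <-> ple x (pre f y)),
      (forall (A B D X : C) (f : A ~> D) (g : B ~> D) (p : X ~> A) (q : X ~> B),
         IsPullback f g p q ->
         forall x : R A, ple (pre g (ex A D f x)) (ex X B q (pre p x)))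
    & (forall (A B : C) (f : A ~> B) (x : R A) (y : R B),
         ple (pmeet (ex A B f x) y) (ex A B f (pmeet x (pre f y))))].

Definition pre_universal : Prop :=
  forall (A B : C) (f : A ~> B) (x : R A), exists z : R B,
  forall y : R B, ple (pre f y) x <-> ple y z.

(** The Kripke form of implication mentions only the order, so it transfers along equivalences of
    preorders. *)
Definition pre_imp (H : PreInfSl) : Prop :=
  forall x y : H, exists z : H, forall w : H,
    ple w z <-> (forall v : H, ple v w -> ple v x -> ple v y).

Definition pre_heyting (H : PreInfSl) : Prop :=
  [/\ (exists b : H, forall x : H, ple b x),
      (forall x y : H, exists z : H, forall w : H, ple z w <-> ple x w /\ ple y w)
    & pre_imp H].

Definition pre_weak_powers {L : FinLim C} : Prop :=
  forall X : C, exists (PX : C) (mem : R (prod X PX)),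
  forall (Y : C) (b : R (prod X Y)), exists chi : Y ~> PX,
    forall z, ple z b <-> ple z (pre (prod_map (idm X) chi) mem).

Lemma rle_clsr (H : PreInfSl) (x : posetReflection H) (y : H) :
  x ≤ cls peq y <-> ple (repr x) y.
Proof. by rewrite -{1}(reprK x); exact: rle_cls. Qed.

Lemma rle_clsl (H : PreInfSl) (x : H) (y : posetReflection H) :
  (cls peq x : posetReflection H) ≤ y <-> ple x (repr y).
Proof. by rewrite -{1}(reprK y); exact: rle_cls. Qed.

Lemma rmeet_cls (H : PreInfSl) (x y : H) :
  (cls peq x : posetReflection H) ⊓ (cls peq y : posetReflection H)
    = cls peq (pmeet x y) :> posetReflection H.
Proof.
have [l1 l2] := proj1 (ple_meet x y _) (ple_refl _).
apply: le_anti.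
  apply/rle_clsr/ple_meet; split; apply/rle_clsr; [exact: meet_lel|exact: meet_ler].
by apply/le_meet; split; apply/rle_cls.
Qed.

Lemma reflection_existential :
  pre_existential -> FullExistential (doctrineReflection R).
Proof.
case=> ex [adj bc frob].
have exle A B (f : A ~> B) x y : ple x y -> ple (ex A B f x) (ex A B f y).
  by move=> l; apply/adj/(ple_trans l)/adj/ple_refl.
pose rex A B (f : A ~> B) (x : posetReflection (R A)) : posetReflection (R B) :=
  cls peq (ex A B f (repr x)).
have rexE A B (f : A ~> B) x : rex A B f (cls peq x) = cls peq (ex A B f x).
  have [l1 l2] := repr_cls (peq_equiv _) x.
  by apply: le_anti; apply/rle_cls/exle.
have radj A B (f : A ~> B) x y : rex A B f x ≤ y <-> x ≤ rreidx R f y.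
  by rewrite rle_clsl adj rle_clsr.
exists rex; split=> // [A B D X f g p q pbk x|A B f x y].
  apply: le_anti.
    rewrite -(reprK x) rexE /= !rpre_cls rexE; apply/rle_cls; exact: bc.
  (* The converse inequality is the unit of the adjunction for [f], reindexed along [p]. *)
  apply/radj; have -> : rreidx R q (rreidx R g (rex A D f x)) =
      rreidx R p (rreidx R f (rex A D f x)).
    by rewrite -!rreidx_comp (proj1 pbk).
  by apply: hom_le; apply/radj; exact: le_refl.
apply: le_anti.
  apply/radj; rewrite hom_meet; apply/le_meet; split; last exact: meet_ler.
  by apply: le_trans (meet_lel _ _) _; apply/radj; exact: le_refl.
rewrite -(reprK x) -(reprK y) rexE [reidx _ _ _]/= rpre_cls !rmeet_cls rexE.
by apply/rle_cls; exact: frob.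
Qed.

Lemma reflection_heyting (H : PreInfSl) :
  pre_heyting H -> inhabited (Heyting (posetReflection H)).
Proof.
case=> [[b hb] hj hi].
pose j (x y : posetReflection H) := constructive_indefinite_description _ (hj (repr x) (repr y)).
pose i (x y : posetReflection H) := constructive_indefinite_description _ (hi (repr x) (repr y)).
constructor.
exists (cls peq b) (fun x y => cls peq (proj1_sig (j x y)))
  (fun x y => cls peq (proj1_sig (i x y))) => [x|x y z|x y z].
- by apply/rle_clsl.
- by rewrite rle_clsl; case: (j x y).
- rewrite rle_clsr (proj2_sig (i x y)).
  split=> [h|h v l1 l2].
    rewrite -{1}(reprK x) -{1}(reprK z) rmeet_cls; apply/rle_clsl.
    have [l1 l2] := proj1 (ple_meet (repr z) (repr x) _) (ple_refl _).
    exact: h.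
  apply/rle_clsl/(le_trans _ h)/le_meet.
  by split; apply/rle_clsl.
Qed.

Lemma reflection_first_order :
  pre_existential -> pre_universal -> (forall A : C, pre_heyting (R A)) ->
  FullFirstOrder (doctrineReflection R).
Proof.
move=> /reflection_existential exR univ hey.
apply: full_first_order_of_adjoints => // [A|]; first exact: reflection_heyting.
pose u A B f (x : posetReflection (R A)) :=
  constructive_indefinite_description _ (univ A B f (repr x)).
exists (fun A B f x => cls peq (proj1_sig (u A B f x))) => A B f x y.
by rewrite rle_clsr; case: (u A B f x) => z /= <-; rewrite /= -rle_clsl.
Qed.

Lemma first_order_reflection : FullFirstOrder (doctrineReflection R) ->
  pre_universal /\ forall A : C, pre_imp (R A).
Proof.
case=> _ [h _] [all [adj _]]; split=> [A B f x|A x y].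
  exists (repr (all A B f (cls peq x))) => y.
  by rewrite -rle_clsl -adj /= rpre_cls; exact: iff_sym (rle_cls _ _).
exists (repr (imp (h A) (cls peq x) (cls peq y))) => w.
rewrite -rle_clsl; split=> [/le_imp l v l1 l2|l].
  apply/rle_cls/(le_trans _ l)/le_meet.
  by split; apply/rle_cls.
apply/le_imp; rewrite rmeet_cls; apply/rle_cls.
by have [l1 l2] := proj1 (ple_meet w x _) (ple_refl _); exact: l.
Qed.

Lemma reflection_weak_powers {L : FinLim C} :
  HasWeakPowerObjects (doctrineReflection R) <-> pre_weak_powers.
Proof.
split=> h X; have [PX [mem hm]] := h X.
  exists PX, (repr mem) => Y b; have [chi e] := hm Y (cls peq b); exists chi => z.
  by rewrite -rle_cls e /=; exact: rle_cls.
exists PX, (cls peq mem) => Y b; have [chi e] := hm Y (repr b); exists chi.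
rewrite [reidx _ _ _]/= rpre_cls; apply: (le_anti (i := posetReflection _)).
  by apply/rle_clsr/e/ple_refl.
by apply/rle_clsl/e/ple_refl.
Qed.

End PreDoctrines.

(** * The logic of weak subobjects *)

Section WeakSubobjectTripos.
Context {D : Category} {L : FinLim D}.

(** Existential quantification is composition; the universal property of the square gives the
    Beck-Chevalley comparison. *)
Lemma slice_existential : pre_existential (weakSubobjectPre (D := D)).
Proof.
exists (fun A B f x => existT (fun X => X ~> B) (projT1 x) (f ∘ projT2 x)).
split=> [A B f x y|A B E X f g p q [_ u] x|A B f x y].
- by rewrite slice_preP.
- set y := pre g _.
  have [h /= e] := proj1 (slice_preP _ _ y) (ple_refl y).
  rewrite -compA in e; have [k [[k1 k2] _]] := u _ _ _ (esym e).
  have [w ew] : ple (existT (fun X' => X' ~> X) _ k : sliceInfSl X) (slice_pre p x).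
    by apply/slice_preP; exists h.
  by exists w; rewrite /= -compA -ew k2.
- have sq : projT2 y ∘ pb2 (f ∘ projT2 x) (projT2 y) =
      f ∘ (projT2 x ∘ pb1 (f ∘ projT2 x) (projT2 y)).
    by rewrite -pb_sq compA.
  have e : projT2 x ∘ pb1 (f ∘ projT2 x) (projT2 y) =
      projT2 (slice_pre f y) ∘ pb_pair (esym sq).
    by rewrite /= pb_pair1.
  by exists (pb_pair e); rewrite /= -!compA pb_pair1.
Qed.

(** The pullback projections form the universal pair [k], [j] over [a], so testing all pairs amounts
    to one comparison in the slice over [J]. *)
Lemma slice_universal :
  pre_universal (weakSubobjectPre (D := D)) <-> @has_universals D.
Proof.
split=> [h X J I f g|h J I g x].
  have [[Z z] hz] := h J I g (existT (fun X => X ~> J) X f).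
  exists Z, z => C a.
  rewrite (_ : factors z a <-> ple (existT (fun X => X ~> I) C a : sliceInfSl I)
    (existT (fun X => X ~> I) Z z)) // -hz.
  split=> [[w /= ew] C' k j e|H]; last exact: H (pb_sq _ _).
  by exists (w ∘ pb_pair e); rewrite compA -ew pb_pair1.
have [Z [z hz]] := h _ _ _ (projT2 x) g.
exists (existT (fun X => X ~> I) Z z) => y.
rewrite [X in _ <-> X]hz; split=> [[w /= ew] C' k j e|H]; last exact: H (pb_sq _ _).
by exists (w ∘ pb_pair e); rewrite compA -ew pb_pair1.
Qed.

Lemma slice_weak_powers :
  pre_weak_powers (weakSubobjectPre (D := D)) <-> @has_weak_powers D.
Proof.
split=> h X.
  have [PX [[M m] hm]] := h X; exists PX, M, (fst ∘ m), (snd ∘ m) => Y B b1 b2.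
  have [chi hc] := hm Y (existT _ B (pair b1 b2)); exists chi => C x y.
  rewrite -!factors_pair pair_eta.
  have := hc (existT _ C (pair x y)); rewrite slice_preP /= prod_map_pair comp_idl.
  exact.
have [PX [M [m1 [m2 hm]]]] := h X; exists PX, (existT _ M (pair m1 m2)) => Y [B b].
have [chi hc] := hm Y B (fst ∘ b) (snd ∘ b); exists chi => [[C c]].
have := hc C (fst ∘ c) (snd ∘ c); rewrite -!factors_pair !pair_eta => hcc.
rewrite slice_preP /=.
have -> : prod_map (idm X) chi ∘ c = pair (fst ∘ c) (chi ∘ (snd ∘ c)).
  by rewrite -{1}(pair_eta c) prod_map_pair comp_idl.
exact: hcc.
Qed.

(* Joins and bottom are encoded as in second-order logic. *)
Lemma slice_heyting :
  @has_universals D -> HasGenericProof D -> forall A : D, pre_heyting (sliceInfSl A).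
Proof.
move=> univ /has_generic_proofP [T [Λ [θ gen]]] A; split.
(* Bottom is [∀ λ : Λ, θ λ]; it lies below [x] by taking for [λ] the name of [x]. *)
- have [Z [z hz]] := representable_forall (A := A) univ
    (representable_comp snd (representable_factors θ)).
  exists (existT _ Z z) => x; have [v hv] := gen _ _ (projT2 x); apply/hv.
  have := proj1 (hz _ z) (factors_id z) _ (idm Z) (v ∘ z).
  by rewrite snd_pair.
- move=> x y.
  (* The formula [w ⇒ θ λ], with variables in [A] and [Λ]. *)
  have imp_repr (w : slice A) : representable (fun C (c : C ~> prod A Λ) =>
      forall C' (k : C' ~> C),
        factors (projT2 w) (fst ∘ (c ∘ k)) -> factors θ (snd ∘ (c ∘ k))).
    by apply: (representable_imp univ
      (representable_comp fst (representable_factors (projT2 w)))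
      (representable_comp snd (representable_factors θ))).
  (* The join is [∀ λ, (x ⇒ θ λ) ∧ (y ⇒ θ λ) ⇒ θ λ]. *)
  have [Z [z hz]] := representable_forall univ (representable_imp univ
    (representable_and (imp_repr x) (imp_repr y))
    (representable_comp snd (representable_factors θ))).
  exists (existT _ Z z) => w; split=> [lw|[lx ly]].
    split; apply: slice_le_trans lw; apply/hz => C' k l C'' k' [hx hy].
      have := hx _ (idm _); rewrite comp_idr; apply.
      by rewrite compA fst_pair -compA; apply: factors_comp; exact: factors_id.
    have := hy _ (idm _); rewrite comp_idr; apply.
    by rewrite compA fst_pair -compA; apply: factors_comp; exact: factors_id.
  (* Elimination into [w] instantiates [λ] with the name of [w]. *)
  have [v hv] := gen _ _ (projT2 w); apply/hv.
  have := proj1 (hz _ z) (factors_id z) _ (idm Z) (v ∘ z) _ (idm Z).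
  rewrite !comp_idr snd_pair; apply; split=> C' k.
    rewrite !compA fst_pair snd_pair -compA => h; apply/hv.
    exact: factors_trans h.
  rewrite !compA fst_pair snd_pair -compA => h; apply/hv.
  exact: factors_trans h.
- move=> x y.
  have [Z [z hz]] := representable_imp univ
    (representable_factors (projT2 x)) (representable_factors (projT2 y)).
  exists (existT _ Z z) => w; rewrite [X in X <-> _]hz.
  split=> [h v [u e] lx|h C' k hx].
    by rewrite /= /slice_le e; apply: h; rewrite -e.
  by apply: (h (existT _ C' (projT2 w ∘ k))) => //; exists k.
Qed.

Lemma weak_subobject_triposP :
  FullTripos (weakSubobject D) <-> @has_universals D /\ @has_weak_powers D.
Proof.
split=> [[/first_order_reflection [hu _] /reflection_weak_powers hp]|[hu hp]].
  by split; [apply/slice_universal|apply/slice_weak_powers].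
split; last by apply/reflection_weak_powers/slice_weak_powers.
apply: reflection_first_order; first exact: slice_existential.
  by apply/slice_universal.
by apply: slice_heyting => //; exact: weak_powers_generic.
Qed.

End WeakSubobjectTripos.

(** * The existential completion *)

Section ExistentialCompletionTripos.
Context {C : Category} {L : FinLim C} (P : Doctrine C).

Definition full (A : C) : points P := Point (top : P A).

Lemma to_full_proof (X : points P) (B : C) (f : pt_ob X ~> B) :
  pt_pred X ≤ reidx P f (pt_pred (full B)).
Proof. by rewrite hom_top; exact: le_top. Qed.

Definition to_full {X : points P} {B : C} (f : pt_ob X ~> B) : X ~> full B :=
  mk_pointHom (to_full_proof f).

(** Over [full A] the inequality demanded of arrows of points holds automatically, so these arrows
    are exactly the elements of the completion at [A]. *)
Definition slice_of {A : C} (x : exElt P A) : slice (full A) :=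
  existT (fun X => X ~> full A) (Point (ex_pred x)) (@to_full (Point _) _ (ex_arr x)).

Definition of_slice {A : C} (z : slice (full A)) : exElt P A :=
  ExElt (proj1_sig (projT2 z)) (pt_pred (projT1 z)).

Lemma of_sliceK {A : C} (z : slice (full A)) : slice_of (of_slice z) = z.
Proof. by case: z => [[B b] f]; rewrite /slice_of; congr existT; apply: sig_eq. Qed.

Lemma slice_of_le {A : C} (x y : exElt P A) :
  ex_le x y <-> slice_le (slice_of x) (slice_of y).
Proof.
split=> [[h [e l]]|[[h l] /(f_equal (@proj1_sig _ _)) /= e]]; last by exists h.
by exists (@mk_pointHom _ _ (Point _) (Point _) h l); apply: sig_eq.
Qed.

(** The pullback of points has the same underlying object, but its predicate carries an extra meet
    with a reindexed [top]; the two agree only up to equivalence. *)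
Lemma slice_of_pre {A B : C} (f : A ~> B) (x : exElt P B) (z : exElt P A) :
  ex_le (ex_pre f x) z <->
  slice_le (slice_pre (@to_full (full A) _ f) (slice_of x)) (slice_of z).
Proof.
rewrite slice_of_le; split; apply: slice_le_trans.
  have l : reidx P (pb1 f (ex_arr x)) top ⊓ reidx P (pb2 f (ex_arr x)) (ex_pred x) ≤
      reidx P (idm _) (reidx P (pb2 f (ex_arr x)) (ex_pred x)).
    by rewrite reidx_id; exact: meet_ler.
  exists (@mk_pointHom _ _ (Point _) (Point _) _ l).
  by apply: sig_eq; rewrite /= comp_idr.
apply/slice_preP.
exists (@mk_pointHom _ _ (Point _) (Point _) (pb2 f (ex_arr x)) (le_refl _)).
by apply: sig_eq; exact: pb_sq.
Qed.

Lemma completion_existential : pre_existential (existentialCompletionPre P).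
Proof.
exists (fun A B f x => ExElt (f ∘ ex_arr x) (ex_pred x)).
split=> [A B f x y|A B E X f g p q [_ u] x|A B f x y].
- by rewrite ex_preP.
- set y := pre g _.
  have [h [/= e l]] := proj1 (ex_preP _ _ y) (ple_refl y).
  rewrite -compA in e; have [k [[k1 k2] _]] := u _ _ _ (esym e).
  have [w [ew lw]] : ple (ExElt k (ex_pred y) : exInfSl P X) (ex_pre p x).
    by apply/ex_preP; exists h.
  by exists w; split=> //; rewrite /= -compA -ew k2.
- have sq : ex_arr y ∘ pb2 (f ∘ ex_arr x) (ex_arr y) =
      f ∘ (ex_arr x ∘ pb1 (f ∘ ex_arr x) (ex_arr y)).
    by rewrite -pb_sq compA.
  have e : ex_arr x ∘ pb1 (f ∘ ex_arr x) (ex_arr y) =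
      ex_arr (ex_pre f y) ∘ pb_pair (esym sq).
    by rewrite /= pb_pair1.
  exists (pb_pair e); split; first by rewrite /= -!compA pb_pair1.
  by rewrite /= hom_meet -!reidx_comp !pb_pair1 !pb_pair2; exact: le_refl.
Qed.

Lemma completion_universal :
  @has_universals (points P) -> pre_universal (existentialCompletionPre P).
Proof.
move/slice_universal=> h A B f x.
have [z hz] := h _ _ (@to_full (full A) _ f) (slice_of x).
exists (of_slice z) => y; rewrite [X in X <-> _]slice_of_pre [X in X <-> _]hz.
by rewrite [X in _ <-> X]slice_of_le of_sliceK.
Qed.

Lemma completion_heyting :
  @has_universals (points P) -> HasGenericProof (points P) ->
  forall A : C, pre_heyting (exInfSl P A).
Proof.
move=> univ gen A; have [[b hb] hj hi] := slice_heyting univ gen (full A).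
have leE (x y : exInfSl P A) :
    ple x y <-> ple (slice_of x : sliceInfSl (full A)) (slice_of y).
  exact: slice_of_le.
split.
- by exists (of_slice b) => x; rewrite leE of_sliceK; exact: hb.
- move=> x y; have [z hz] := hj (slice_of x) (slice_of y); exists (of_slice z) => w.
  by rewrite !leE of_sliceK.
- move=> x y; have [z hz] := hi (slice_of x) (slice_of y); exists (of_slice z) => w.
  rewrite leE of_sliceK hz.
  split=> h v; first by rewrite !leE; exact: h.
  by have := h (of_slice v); rewrite !leE of_sliceK.
Qed.

(** The predicate of [Y] does not enter the right side: the slice over [Y] embeds in the fibre over
    its underlying object. *)
Lemma factors_points {X Y Z : points P} (f : X ~> Y) (g : Z ~> Y) :
  factors f g <->
  ex_le (ExElt (proj1_sig g) (pt_pred Z)) (ExElt (proj1_sig f) (pt_pred X)).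
Proof.
split=> [[u ->]|[u [e l]]]; first by exists (proj1_sig u); split=> //; exact: (proj2_sig u).
by exists (mk_pointHom l); exact: sig_eq.
Qed.

Lemma factors2_points {X Y R Z : points P} (s : R ~> X) (t : R ~> Y)
    (x : Z ~> X) (y : Z ~> Y) :
  factors2 s t x y <->
  ex_le (ExElt (pair (proj1_sig x) (proj1_sig y)) (pt_pred Z))
        (ExElt (pair (proj1_sig s) (proj1_sig t)) (pt_pred R)).
Proof.
split=> [[u [-> ->]]|[u []]].
  by exists (proj1_sig u); rewrite /= pair_comp; split=> //; exact: (proj2_sig u).
rewrite /= pair_comp => /pair_inj [e1 e2] l.
by exists (mk_pointHom l); split; exact: sig_eq.
Qed.

(** Quantification among points is bounded: it is [∀_g (J ⇒ f)], met with the predicate of [I] so as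
    to become an arrow into [I]. *)
Lemma points_universals :
  pre_universal (existentialCompletionPre P) ->
  (forall A : C, pre_imp (exInfSl P A)) -> @has_universals (points P).
Proof.
move=> univ imp X J I f g.
have [φ hφ] := imp _ (ExElt (idm _) (pt_pred J)) (ExElt (proj1_sig f) (pt_pred X)).
have [z hz] := univ _ _ (proj1_sig g) φ.
pose z' : exInfSl P (pt_ob I) := pmeet z (ExElt (idm _) (pt_pred I)).
have [_ [h [eh lh]]] := proj1 (ple_meet _ _ z') (ple_refl z').
have lz : ex_pred z' ≤ reidx P (ex_arr z') (pt_pred I) by rewrite eh comp_idl.
exists (Point (ex_pred z')), (@mk_pointHom _ _ (Point _) _ _ lz) => Z a.
rewrite factors_points [X in X <-> _](ple_meet z).
have la : ex_le (ExElt (proj1_sig a) (pt_pred Z)) (ExElt (idm _) (pt_pred I)).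
  by exists (proj1_sig a); rewrite comp_idl; split=> //; exact: (proj2_sig a).
rewrite -hz hφ; split=> [[H _] Z' k j /(f_equal (@proj1_sig _ _)) e|H].
  apply/factors_points/H.
    by apply/ex_preP; exists (proj1_sig k); split=> //; exact: (proj2_sig k).
  by exists (proj1_sig j); rewrite comp_idl; split=> //; exact: (proj2_sig j).
(* The test element [v] becomes a stage among the points; [lk] and [lj] make its two legs arrows. *)
split=> // v /ex_preP [k [ek lk]] [j [ej lj]].
rewrite comp_idl in ej; subst j.
apply: (proj1 (factors_points f (@mk_pointHom _ _ (Point (ex_pred v)) _ _ lj))).
by apply: (H (Point (ex_pred v)) (@mk_pointHom _ _ (Point (ex_pred v)) _ _ lk)); exact: sig_eq.
Qed.

Lemma completion_weak_powers :
  @has_weak_powers (points P) -> pre_weak_powers (existentialCompletionPre P).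
Proof.
move=> wp X; have [PX [M [m1 [m2 hm]]]] := wp (full X).
exists (pt_ob PX), (ExElt (pair (proj1_sig m1) (proj1_sig m2)) (pt_pred M)) => Y b.
have [chi hc] := hm (full Y) (Point (ex_pred b))
  (to_full (X := Point _) (fst ∘ ex_arr b)) (to_full (X := Point _) (snd ∘ ex_arr b)).
exists (proj1_sig chi) => z.
have := hc (Point (ex_pred z))
  (to_full (X := Point _) (fst ∘ ex_arr z)) (to_full (X := Point _) (snd ∘ ex_arr z)).
rewrite !factors2_points /= !pair_eta => {}hc.
rewrite [X in _ <-> X]ex_preP /=.
have -> : prod_map (idm X) (proj1_sig chi) ∘ ex_arr z =
    pair (fst ∘ ex_arr z) (proj1_sig chi ∘ (snd ∘ ex_arr z)).
  by rewrite -{1}(pair_eta (ex_arr z)) prod_map_pair comp_idl.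
exact: hc.
Qed.

Lemma points_weak_powers :
  pre_weak_powers (existentialCompletionPre P) -> @has_weak_powers (points P).
Proof.
move=> wp X; have [Q [m hm]] := wp (pt_ob X).
(* The meet makes the first leg an arrow into [X]; on tests it is harmless, as [x] already satisfies
   the predicate of [X]. *)
exists (full Q), (Point (ex_pred m ⊓ reidx P (fst ∘ ex_arr m) (pt_pred X))).
exists (@mk_pointHom _ _ (Point _) _ _ (meet_ler _ _)).
exists (to_full (X := Point _) (snd ∘ ex_arr m)) => Y B b1 b2.
have [chi hc] := hm (pt_ob Y) (ExElt (pair (proj1_sig b1) (proj1_sig b2)) (pt_pred B)).
exists (to_full chi) => Z x y; rewrite !factors2_points /= pair_eta.
rewrite [X in X <-> _](hc (ExElt _ _)) [X in X <-> _]ex_preP /= prod_map_pair comp_idl.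
split=> [] [h [e l]]; exists h; split=> //=; last first.
  by apply: le_trans l _; apply: hom_le; exact: meet_lel.
rewrite hom_meet; apply/le_meet; split=> //.
rewrite -reidx_comp -compA -e fst_pair; exact: (proj2_sig x).
Qed.

Lemma completion_triposP :
  FullTripos (existentialCompletion P) <->
  @has_universals (points P) /\ @has_weak_powers (points P).
Proof.
split=> [[/first_order_reflection [hu hi] /reflection_weak_powers hp]|[hu hp]].
  by split; [exact: points_universals|exact: points_weak_powers].
split; last by apply/reflection_weak_powers/completion_weak_powers.
apply: reflection_first_order; first exact: completion_existential.
  exact: completion_universal.
by apply: completion_heyting => //; exact: weak_powers_generic.
Qed.

End ExistentialCompletionTripos.

(** * Power objects and quantifiers in a topos *)

Section PowerObjects.
Context {E : Category} {L : FinLim E}.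

Lemma classifier_pullback {Ω U X : E} (true_ : one ~> Ω) (m : U ~> X) (chi : X ~> Ω) :
  IsMono m ->
  (forall C (x : C ~> X), factors m x <-> chi ∘ x = true_ ∘ bang C) ->
  IsPullback chi true_ m (bang U).
Proof.
move=> hm h; split=> [|C a b]; first by apply/h/factors_id.
rewrite (bang_uniq b (bang C)) => /h [u ->]; exists u; split=> [|v [/hm ->]] //.
by split=> //; exact: bang_uniq.
Qed.

Lemma classifier_factors : HasSubobjectClassifier E ->
  exists (Ω : E) (true_ : one ~> Ω),
  (forall (U X : E) (m : U ~> X), IsMono m -> exists chi : X ~> Ω,
    forall C (x : C ~> X), factors m x <-> chi ∘ x = true_ ∘ bang C) /\
  (forall (X : E) (chi chi' : X ~> Ω),
    (forall C (x : C ~> X), chi ∘ x = true_ ∘ bang C <-> chi' ∘ x = true_ ∘ bang C) ->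
    chi = chi').
Proof.
case=> Ω [true_ cl]; exists Ω, true_; split=> [U X m hm|X chi chi' h].
  have [chi [[sq uni] _]] := cl U X m hm; exists chi => C x; split=> [[u ->]|e].
    by rewrite compA sq -compA (bang_uniq (bang U ∘ u) (bang C)).
  by have [u [[<- _] _]] := uni _ _ _ e; exists u.
(* Both arrows classify the pullback of [true_] along [chi], so uniqueness identifies them. *)
have hm : IsMono (pb1 chi true_).
  by move=> C u v e; apply: pb_ext => //; exact: bang_uniq.
have fm C (x : C ~> X) : factors (pb1 chi true_) x <-> chi ∘ x = true_ ∘ bang C.
  rewrite factors_pb1; split=> [[u ->]|->]; last by exists (bang C).
  by rewrite (bang_uniq u (bang C)).
have [c [_ uni]] := cl _ _ _ hm.
transitivity c; [symmetry|]; apply: uni; apply: classifier_pullback => // C x.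
by rewrite fm h.
Qed.

Hypotheses (exponentials : HasExponentials E) (classifier : HasSubobjectClassifier E).

(** The power object is the exponential of [Ω] by [X], with membership the pullback of [true_] along
    evaluation; unique transposes give extensionality. *)
Lemma topos_powers (X : E) : exists (PX M : E) (m1 : M ~> X) (m2 : M ~> PX),
  (forall (Y U : E) (b1 : U ~> X) (b2 : U ~> Y), IsMono (pair b2 b1) ->
    exists chi : Y ~> PX, forall C (x : C ~> X) (y : C ~> Y),
      factors2 b1 b2 x y <-> factors2 m1 m2 x (chi ∘ y)) /\
  (forall (Y : E) (chi chi' : Y ~> PX),
    (forall C (x : C ~> X) (y : C ~> Y),
      factors2 m1 m2 x (chi ∘ y) <-> factors2 m1 m2 x (chi' ∘ y)) ->
    chi = chi').
Proof.
have [Ω [true_ [cl uni]]] := classifier_factors classifier.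
have [PX [ev hev]] := exponentials X Ω.
exists PX, (pb ev true_), (snd ∘ pb1 ev true_), (fst ∘ pb1 ev true_).
have mem C (x : C ~> X) (s : C ~> PX) :
    factors2 (snd ∘ pb1 ev true_) (fst ∘ pb1 ev true_) x s <->
    ev ∘ pair s x = true_ ∘ bang C.
  transitivity (factors (pb1 ev true_) (pair s x)).
    split=> [[u [-> ->]]|[u e]]; exists u; first by rewrite -!compA pair_eta.
    by rewrite -!compA -e fst_pair snd_pair.
  rewrite factors_pb1; split=> [[u ->]|->]; last by exists (bang C).
  by rewrite (bang_uniq u (bang C)).
split=> [Y U b1 b2 hm|Y chi chi' h].
  have [c hc] := cl _ _ _ hm; have [chi [e _]] := hev Y c.
  exists chi => C x y; rewrite mem.
  have -> : pair (chi ∘ y) x = prod_map chi (idm X) ∘ pair y x.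
    by rewrite prod_map_pair comp_idl.
  rewrite compA e -hc.
  by rewrite factors_pair; split=> [] [u []]; exists u.
have [g [_ ug]] := hev Y (ev ∘ prod_map chi (idm X)).
transitivity g; [symmetry|]; apply: ug => //; apply: uni => C c.
by rewrite -(pair_eta c) -!compA !prod_map_pair comp_idl -!mem h.
Qed.

(* The quantification is the equalizer of the transposes of the graph of [g] and of
   its restriction to [U]. *)
Lemma topos_universals {U J I : E} (m : U ~> J) (g : J ~> I) : IsMono m ->
  representable (fun C (a : C ~> I) =>
    forall C' (k : C' ~> C) (j : C' ~> J), g ∘ j = a ∘ k -> factors m j).
Proof.
move=> hm; have [PJ [M [m1 [m2 [tr uni]]]]] := topos_powers J.
have [u hu] : exists u : I ~> PJ, forall C (j : C ~> J) (i : C ~> I),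
    g ∘ j = i <-> factors2 m1 m2 j (u ∘ i).
  have [|u hu] := tr I J (idm J) g.
    by move=> C a b; rewrite !pair_comp !comp_idl => /pair_inj [].
  exists u => C j i; rewrite -hu; split=> [<-|[w [-> ->]]]; last by rewrite comp_idl.
  by exists j; rewrite comp_idl.
have [v hv] : exists v : I ~> PJ, forall C (j : C ~> J) (i : C ~> I),
    factors m j /\ g ∘ j = i <-> factors2 m1 m2 j (v ∘ i).
  have [|v hv] := tr I U m (g ∘ m).
    by move=> C a b; rewrite !pair_comp => /pair_inj [_ /hm].
  exists v => C j i; rewrite -hv; split=> [[[w ->] <-]|[w [-> ->]]].
    by exists w; rewrite compA.
  by split; [exists w|rewrite compA].
apply: (representable_ext _ (representable_eq u v)) => C a; split=> [e C' k j|h].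
  by move/hu; rewrite compA e -compA => /hv [].
apply: uni => C' j k; rewrite -!compA -hu -hv.
by split=> [e|[]] //; split=> //; exact: (h _ k).
Qed.

End PowerObjects.

(** * The exact completion *)

Lemma fin_lim_exists (E : Category) :
  (exists T : E, IsTerminal T) ->
  (forall (A B Z : E) (f : A ~> Z) (g : B ~> Z), exists (X : E) (p : X ~> A) (q : X ~> B),
    IsPullback f g p q) ->
  inhabited (FinLim E).
Proof.
move=> [T hT] hpb.
pose ch A B Z f g := constructive_indefinite_description _ (hpb A B Z f g).
pose ch1 A B Z f g := constructive_indefinite_description _ (proj2_sig (ch A B Z f g)).
pose ch2 A B Z f g := constructive_indefinite_description _ (proj2_sig (ch1 A B Z f g)).
exact: (inhabits (Build_FinLim hT (fun A B Z f g => proj2_sig (ch2 A B Z f g)))).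
Qed.

Section ExLex.
Context {D : Category} {L : FinLim D}.

(* Two generalized elements of the carrier that name the same element of the
   quotient. *)
Definition sim (X : @PseudoEqRel D L) {C : D} (a b : C ~> per_ob X) : Prop :=
  factors2 (per_src X) (per_tgt X) a b.

#[local] Instance sim_equiv (X : @PseudoEqRel D L) (C : D) : Equivalence (@sim X C).
Proof.
split=> [a|a b|a b c].
- have [r [e1 e2]] := per_refl X; exists (r ∘ a).
  by rewrite !compA e1 e2 comp_idl.
- case=> u [-> ->]; have [s [e1 e2]] := per_sym X; exists (s ∘ u).
  by rewrite !compA e1 e2.
- case=> u [-> e] [v [e' ->]]; have [t [e1 e2]] := per_trans X.
  have sq : per_tgt X ∘ u = per_src X ∘ v by rewrite -e -e'.
  by exists (t ∘ pb_pair sq); rewrite !compA e1 e2 -!compA pb_pair1 pb_pair2.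
Qed.

#[local] Hint Extern 0 (sim _ _) => reflexivity : core.

Lemma sim_comp (X : @PseudoEqRel D L) (C C' : D) (a b : C ~> per_ob X) (k : C' ~> C) :
  sim a b -> sim (a ∘ k) (b ∘ k).
Proof. exact: factors2_comp. Qed.

Lemma representable_sim {A : D} (X : @PseudoEqRel D L) (u v : A ~> per_ob X) :
  representable (fun C (a : C ~> A) => sim (u ∘ a) (v ∘ a)).
Proof.
apply: (representable_ext _ (representable_comp (pair u v)
  (representable_factors (pair (per_src X) (per_tgt X))))) => C a.
by rewrite pair_comp factors_pair.
Qed.

(** * Objects and arrows of the exact completion through generalized elements *)

Section MakePER.
Context {A R : D} (s t : R ~> A) (eqv : forall C : D, Equivalence (@factors2 _ _ _ _ C s t)).

(** By Yoneda, the structure arrows are the equivalence laws read at universal elements. *)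
Definition per_of : @PseudoEqRel D L.
Proof.
refine (@Build_PseudoEqRel D L A R s t _ _ _).
- by have [u [e1 e2]] := reflexivity (R := factors2 s t) (idm A); exists u.
- by have [u [e1 e2]] := symmetry (factors2_id s t); exists u.
- have [] : factors2 s t (s ∘ pb1 t s) (t ∘ pb2 t s).
    by transitivity (t ∘ pb1 t s); [exists (pb1 t s)|exists (pb2 t s); rewrite pb_sq].
  by move=> u [e1 e2]; exists u.
Defined.

End MakePER.

(** Quotients by comprehension: an object of the exact completion can be given by a formula for its
    equality. *)
Lemma per_exists {A : D} (Φ : forall C : D, C ~> A -> C ~> A -> Prop) :
  representable (fun C (c : C ~> prod A A) => Φ C (fst ∘ c) (snd ∘ c)) ->
  (forall C : D, Equivalence (Φ C)) ->
  exists (R : D) (s t : R ~> A) eqv,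
  forall (C : D) (a b : C ~> A), sim (X := @per_of A R s t eqv) a b <-> Φ C a b.
Proof.
case=> R [r h] eqv; exists R, (fst ∘ r), (snd ∘ r).
have hr (C : D) (a b : C ~> A) : factors2 (fst ∘ r) (snd ∘ r) a b <-> Φ C a b.
  by rewrite -factors_pair pair_eta h fst_pair snd_pair.
unshelve eexists; last exact: hr.
move=> C; split=> [a|a b /hr l|a b c /hr l1 /hr l2]; apply/hr.
- by reflexivity.
- by symmetry.
- by transitivity b.
Qed.

(** The image of [A] under the embedding of [D], a projective object. *)
Definition discrete (A : D) : exLex D.
Proof.
apply: (@per_of A A (idm A) (idm A)) => C.
by split=> [a|a b [u [-> ->]]|a b c [u [-> ->]] [v [-> ->]]];
  [exists a|exists u|exists v]; rewrite ?comp_idl.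
Defined.

Lemma sim_discrete {A C : D} (a b : C ~> A) : sim (X := discrete A) a b <-> a = b.
Proof. by split=> [[u [-> ->]]|->] //; reflexivity. Qed.

(** A chosen representative, meaningful only up to [sim]. *)
Definition under {X Y : exLex D} (F : X ~> Y) : per_ob X ~> per_ob Y :=
  proj1_sig (repr F).

Lemma track_proof {X Y : @PseudoEqRel D L} (f : per_ob X ~> per_ob Y)
  (h : forall C (a b : C ~> per_ob X), sim a b -> sim (f ∘ a) (f ∘ b)) :
  exists f1 : per_rel X ~> per_rel Y,
    per_src Y ∘ f1 = f ∘ per_src X /\ per_tgt Y ∘ f1 = f ∘ per_tgt X.
Proof. by have [u [e1 e2]] := h _ _ _ (factors2_id _ _); exists u. Qed.

Definition ex_arrow {X Y : @PseudoEqRel D L} (f : per_ob X ~> per_ob Y)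
  (h : forall C (a b : C ~> per_ob X), sim a b -> sim (f ∘ a) (f ∘ b)) :
  Hom (c := exLex D) X Y := cls perArr_eq (exist _ f (track_proof h)).

Lemma perArr_eq_sim {X Y : @PseudoEqRel D L} (f g : perArr X Y) :
  perArr_eq f g <-> sim (proj1_sig f) (proj1_sig g).
Proof. by split=> [] [u [e1 e2]]; exists u. Qed.

Lemma under_cls {X Y : @PseudoEqRel D L} (f : perArr X Y) :
  sim (under (cls perArr_eq f : Hom (c := exLex D) X Y)) (proj1_sig f).
Proof. by apply/perArr_eq_sim/(repr_cls (perArr_equiv X Y)). Qed.

Lemma under_arrow {X Y : @PseudoEqRel D L} f h {C : D} (a : C ~> per_ob X) :
  sim (under (@ex_arrow X Y f h) ∘ a) (f ∘ a).
Proof. exact/sim_comp/under_cls. Qed.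

Lemma under_arrow0 {X Y : @PseudoEqRel D L} f h : sim (under (@ex_arrow X Y f h)) f.
Proof. exact: under_cls. Qed.

Lemma under_sim {X Y : exLex D} (F : X ~> Y) (C : D) (a b : C ~> per_ob X) :
  sim a b -> sim (under F ∘ a) (under F ∘ b).
Proof.
case=> [u [-> ->]]; rewrite /under; case: (repr F) => f [f1 [e1 e2]].
by exists (f1 ∘ u); rewrite /= !compA e1 e2.
Qed.

#[local] Instance under_proper {X Y : exLex D} (F : X ~> Y) (C : D) :
  Proper (@sim X C ==> @sim Y C) (comp (under F)).
Proof. exact: under_sim. Qed.

Lemma under_ext {X Y : exLex D} (F G : X ~> Y) : sim (under F) (under G) -> F = G.
Proof.
rewrite -perArr_eq_sim => h; rewrite -(reprK F) -(reprK G).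
by apply/(cls_eq (perArr_equiv X Y)).
Qed.

Lemma under_comp0 {X Y Z : exLex D} (G : Y ~> Z) (F : X ~> Y) :
  sim (under (G ∘ F)) (under G ∘ under F).
Proof. exact: under_cls. Qed.

Lemma under_comp {X Y Z : exLex D} (G : Y ~> Z) (F : X ~> Y)
    {C : D} (a : C ~> per_ob X) :
  sim (under (G ∘ F) ∘ a) (under G ∘ (under F ∘ a)).
Proof. rewrite compA; apply: sim_comp; exact: under_comp0. Qed.

Lemma under_id (X : exLex D) {C : D} (a : C ~> per_ob X) : sim (under (idm X) ∘ a) a.
Proof. rewrite -{2}(comp_idl a); apply: sim_comp; exact: under_cls. Qed.

(** Generalized elements of the carrier, up to [sim], are the arrows from discrete objects. *)
Definition element {X : exLex D} {C : D} (a : C ~> per_ob X) : discrete C ~> X.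
Proof.
by apply: (@ex_arrow (discrete C) X a) => C' u v /sim_discrete ->; reflexivity.
Defined.

Lemma under_element {X : exLex D} {C : D} (a : C ~> per_ob X) :
  sim (under (element a)) a.
Proof. exact: under_cls. Qed.

Lemma element_sim {X : exLex D} {C : D} (a b : C ~> per_ob X) :
  element a = element b <-> sim a b.
Proof.
split=> [e|h]; first by rewrite -(under_element a) e under_element.
by apply: under_ext; rewrite !under_element.
Qed.

Lemma comp_element {X Y : exLex D} (F : X ~> Y) {C : D} (a : C ~> per_ob X) :
  F ∘ element a = element (under F ∘ a).
Proof.
by apply: under_ext; rewrite under_element under_comp0 under_element.
Qed.

(** * Finite limits of the exact completion *)

Lemma exlex_terminal : exists T : exLex D, IsTerminal T.
Proof.
exists (discrete one) => X.
have h C (a b : C ~> per_ob X) : sim a b ->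
    sim (X := discrete one) (bang _ ∘ a) (bang _ ∘ b).
  by move=> _; apply/sim_discrete; exact: bang_uniq.
exists (ex_arrow h); split=> // g _.
by apply/under_ext/sim_discrete; exact: bang_uniq.
Qed.

(** The carrier consists of pairs with a proof that their images are equal; equality is
    componentwise and ignores the proof. *)
Lemma exlex_pullbacks (A B Z : exLex D) (f : A ~> Z) (g : B ~> Z) :
  exists (X : exLex D) (p : X ~> A) (q : X ~> B), IsPullback f g p q.
Proof.
have [R [r hr]] := representable_sim (under f ∘ fst) (under g ∘ (snd : prod _ _ ~> per_ob B)).
have [S [s [t [eqv hs]]]] : exists (S : D) (s t : S ~> R) eqv,
    forall C (a b : C ~> R), sim (X := @per_of R S s t eqv) a b <->
      sim (fst ∘ r ∘ a) (fst ∘ r ∘ b) /\ sim (snd ∘ r ∘ a) (snd ∘ r ∘ b).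
  apply: (per_exists (Φ := fun C (a b : C ~> R) => _)); last first.
    move=> C; split=> [//|a b [h1 h2]|a b c [h1 h2] [h3 h4]].
      by split; symmetry.
    by split; [transitivity (fst ∘ r ∘ b)|transitivity (snd ∘ r ∘ b)].
  apply: (representable_ext _ (representable_and
    (representable_sim (fst ∘ r ∘ fst) (fst ∘ r ∘ snd))
    (representable_sim (snd ∘ r ∘ fst) (snd ∘ r ∘ snd)))) => C c.
  by rewrite !compA.
pose X : @exLex D L := per_of eqv.
have hp C (a b : C ~> per_ob X) : sim a b -> sim (fst ∘ r ∘ a) (fst ∘ r ∘ b).
  by move/hs=> [].
have hq C (a b : C ~> per_ob X) : sim a b -> sim (snd ∘ r ∘ a) (snd ∘ r ∘ b).
  by move/hs=> [].
exists X, (ex_arrow hp), (ex_arrow hq); split.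
  apply: under_ext; rewrite !under_comp0 !under_arrow0.
  by have := proj1 (hr _ r) (factors_id r); rewrite -!compA.
move=> Y a b e.
have : factors r (pair (under a) (under b)).
  apply/hr; rewrite -!compA fst_pair snd_pair.
  by rewrite -!under_comp0 e.
move=> [h0 e0].
have ea : fst ∘ r ∘ h0 = under a by rewrite -compA -e0 fst_pair.
have eb : snd ∘ r ∘ h0 = under b by rewrite -compA -e0 snd_pair.
have hh C (u v : C ~> per_ob Y) : sim u v -> sim (X := X) (h0 ∘ u) (h0 ∘ v).
  by move=> huv; apply/hs; rewrite !compA ea eb huv.
exists (ex_arrow hh); split.
  split; by apply: under_ext; rewrite under_comp0 (under_arrow0 hh) under_arrow ?ea ?eb.
move=> k [ka kb]; apply/under_ext; rewrite under_arrow0; apply/hs; rewrite ea eb.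
by rewrite -ka -kb !under_comp0 !under_arrow.
Qed.

(** * Exponentials and the subobject classifier of the exact completion *)

Section Topos.
Context {LE : FinLim (@exLex D L)}.

(** The finite limits are arbitrary here, so elements of the carrier of a product are reached
    through arrows from discrete objects. *)
Lemma prod_element (X Y : exLex D) (C : D) (x : C ~> per_ob X) (y : C ~> per_ob Y) :
  exists c : C ~> per_ob (prod X Y),
    sim (under (fst : prod X Y ~> X) ∘ c) x /\ sim (under (snd : prod X Y ~> Y) ∘ c) y.
Proof.
exists (under (pair (element x) (element y))).
split.
  by rewrite -(under_comp0 fst (pair (element x) (element y))) fst_pair under_element.
by rewrite -(under_comp0 snd (pair (element x) (element y))) snd_pair under_element.
Qed.

Lemma prod_sim (X Y : exLex D) (C : D) (c c' : C ~> per_ob (prod X Y)) :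
  sim (under (fst : prod X Y ~> X) ∘ c) (under (fst : prod X Y ~> X) ∘ c') ->
  sim (under (snd : prod X Y ~> Y) ∘ c) (under (snd : prod X Y ~> Y) ∘ c') ->
  sim c c'.
Proof.
by move=> h1 h2; apply/element_sim/prod_ext; rewrite !comp_element; apply/element_sim.
Qed.

Hypothesis univ : @has_universals D.

Lemma exlex_exponentials : HasWeakDependentProducts D -> HasExponentials (exLex D).
Proof.
move=> wdp A B.
have [W [ev hev]] := wdp_weak_exponentials (per_ob A) (per_ob B) wdp.
(* [Z0] consists of the codes in [W] of maps that respect the relation of [A]. *)
have [Z0 [ι hι]] : representable (fun C (w : C ~> W) =>
    forall C' (k : C' ~> C) (r : C' ~> per_rel A),
      sim (X := B) (ev ∘ pair (w ∘ k) (per_src A ∘ r)) (ev ∘ pair (w ∘ k) (per_tgt A ∘ r))).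
  apply: (representable_ext _ (representable_forall univ (representable_sim
    (ev ∘ pair fst (per_src A ∘ snd)) (ev ∘ pair fst (per_tgt A ∘ snd))))) => C w.
  by split=> h C' k r; have := h C' k r; rewrite -!compA !pair_comp -!compA fst_pair snd_pair.
have evA C (z : C ~> Z0) (a a' : C ~> per_ob A) : sim a a' ->
    sim (X := B) (ev ∘ pair (ι ∘ z) a) (ev ∘ pair (ι ∘ z) a').
  case=> r [-> ->]; have := proj1 (hι _ ι) (factors_id _) _ z r.
  by [].
(* Codes are identified when their values agree pointwise in [B]. *)
have [R [s [t [eqv hs]]]] : exists (R : D) (s t : R ~> Z0) eqv,
    forall C (z z' : C ~> Z0), sim (X := @per_of Z0 R s t eqv) z z' <->
      forall C' (k : C' ~> C) (a : C' ~> per_ob A),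
        sim (X := B) (ev ∘ pair (ι ∘ z ∘ k) a) (ev ∘ pair (ι ∘ z' ∘ k) a).
  apply: (per_exists (Φ := fun C (a b : C ~> Z0) => _)); last first.
    move=> C; split=> [//|z z' h C' k a|z1 z2 z3 h h' C' k a].
      by symmetry; exact: h.
    by transitivity (ev ∘ pair (ι ∘ z2 ∘ k) a).
  apply: (representable_ext _ (representable_forall univ (representable_sim
    (ev ∘ pair (ι ∘ fst ∘ fst) snd) (ev ∘ pair (ι ∘ snd ∘ fst) snd)))) => C c.
  split=> h C' k a; have := h C' k a;
  by rewrite -!compA !pair_comp -!compA fst_pair snd_pair.
pose Z : @exLex D L := per_of eqv.
have evZ C (z z' : C ~> Z0) (a a' : C ~> per_ob A) : sim (X := Z) z z' -> sim a a' ->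
    sim (X := B) (ev ∘ pair (ι ∘ z) a) (ev ∘ pair (ι ∘ z') a').
  move=> hz ha; transitivity (ev ∘ pair (ι ∘ z') a); last exact: evA.
  by have := proj1 (hs _ z z') hz _ (idm C) a; rewrite !comp_idr.
pose f1 : @prod _ LE Z A ~> Z := @fst _ LE Z A; pose f2 : @prod _ LE Z A ~> A := @snd _ LE Z A.
have hevZ C (c c' : C ~> per_ob (prod Z A)) : sim c c' ->
    sim (X := B) (ev ∘ pair (ι ∘ under f1) (under f2) ∘ c)
        (ev ∘ pair (ι ∘ under f1) (under f2) ∘ c').
  by move=> h; rewrite -!compA !pair_comp -!compA; apply: evZ; exact: under_sim.
exists Z, (ex_arrow hevZ) => X f.
have evE (g : X ~> Z) C (c : C ~> per_ob (prod X A)) (x : C ~> per_ob X) a :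
    sim (under (fst : prod X A ~> X) ∘ c) x -> sim (under (snd : prod X A ~> A) ∘ c) a ->
    sim (under (ex_arrow hevZ ∘ prod_map g (idm A)) ∘ c) (ev ∘ pair (ι ∘ (under g ∘ x)) a).
  move=> hx ha; rewrite under_comp under_arrow -!compA pair_comp -!compA.
  apply: evZ.
    by rewrite -(under_comp f1 (prod_map g (idm A))) fst_pair under_comp hx.
  by rewrite -(under_comp f2 (prod_map g (idm A))) snd_pair under_comp under_id.
(* [l] compares the product of the carriers with the carrier of the product, so that [f] acquires a
   code [w]. *)
have [l [l1 l2]] := prod_element (fst : prod (per_ob X) (per_ob A) ~> per_ob X) snd.
have [w hw] := hev _ (under f ∘ l).
have key C (c : C ~> per_ob (prod X A)) (x : C ~> per_ob X) a :
    sim (under (fst : prod X A ~> X) ∘ c) x -> sim (under (snd : prod X A ~> A) ∘ c) a ->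
    sim (under f ∘ c) (ev ∘ pair (w ∘ x) a).
  move=> hx ha; rewrite -hw -compA.
  suff -> : sim c (l ∘ pair x a) by [].
  have := sim_comp (pair x a) l1; have := sim_comp (pair x a) l2.
  rewrite -!compA fst_pair snd_pair => h2 h1.
  by apply: prod_sim; rewrite ?h1 ?h2.
have [g0 eg] : factors ι w.
  apply/hι => C k r.
  have [c [c1 c2]] := prod_element k (per_src A ∘ r).
  rewrite -(key _ c) //; apply: key => //.
  by rewrite c2; exists r.
have hg C (x x' : C ~> per_ob X) : sim x x' -> sim (X := Z) (g0 ∘ x) (g0 ∘ x').
  move=> hx; apply/hs => C' k a; rewrite !compA -eg -!compA.
  have [c [c1 c2]] := prod_element (x ∘ k) a.
  rewrite -(key _ c) //; apply: key => //.
  by rewrite c1; apply: sim_comp.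
exists (ex_arrow hg); split.
  apply: under_ext; rewrite -[under (_ ∘ prod_map _ _)]comp_idr evE //.
  rewrite -[under f]comp_idr (key _ (idm _)) // eg -[ι ∘ g0 ∘ _]compA.
  by apply: evZ => //; exact: under_arrow.
move=> g eg'; apply: under_ext; rewrite under_arrow0; apply/hs => C k a.
have [c [c1 c2]] := prod_element k a.
rewrite -!compA -(evE g _ c) // eg' (key _ c k a) // eg compA.
by [].
Qed.

Lemma mono_sim {U X : exLex D} (m : U ~> X) {C : D} (u v : C ~> per_ob U) :
  IsMono m -> sim (under m ∘ u) (under m ∘ v) -> sim u v.
Proof.
by move=> hm /element_sim; rewrite -!comp_element => /hm /element_sim.
Qed.

Lemma exlex_classifier : HasGenericProof D -> HasSubobjectClassifier (exLex D).
Proof.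
move=> /has_generic_proofP [T [Λ [θ gen]]].
(* [Ω] is [Λ] modulo logical equivalence of the propositions named through [θ]. *)
have [R [s [t [eqv hs]]]] : exists (R : D) (s t : R ~> Λ) eqv,
    forall C (l l' : C ~> Λ), sim (X := @per_of Λ R s t eqv) l l' <->
      forall C' (k : C' ~> C), factors θ (l ∘ k) <-> factors θ (l' ∘ k).
  apply: (per_exists (Φ := fun C (l l' : C ~> Λ) => _)); last first.
    move=> C; split=> [//|l l' h C' k|l1 l2 l3 h h' C' k]; first by rewrite h.
    by rewrite h.
  apply: (representable_ext _ (representable_and
    (representable_imp univ (representable_comp fst (representable_factors θ))
      (representable_comp snd (representable_factors θ)))
    (representable_imp univ (representable_comp snd (representable_factors θ))
      (representable_comp fst (representable_factors θ))))) => C c.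
  split=> [[h1 h2] C' k|h]; last by split=> C' k; rewrite !compA => /h.
  by rewrite -!compA; split; [exact: h1|exact: h2].
pose Ω : @exLex D L := per_of eqv.
have hΩ C (l l' : C ~> Λ) : sim (X := Ω) l l' -> factors θ l <-> factors θ l'.
  by move/hs/(_ C (idm C)); rewrite !comp_idr.
have hΩ2 C (l l' : C ~> Λ) : factors θ l -> factors θ l' -> sim (X := Ω) l l'.
  by move=> h h'; apply/hs => C' k; split=> _; exact: factors_comp.
have [tt htt] : exists tt : per_ob (@one _ LE) ~> Λ, forall C (x : C ~> _), factors θ (tt ∘ x).
  have [tt htt] := gen _ _ (idm (per_ob (@one _ LE))).
  by exists tt => C x; apply/htt/factors_idm.
have ht C (a b : C ~> per_ob (@one _ LE)) : sim a b -> sim (X := Ω) (tt ∘ a) (tt ∘ b).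
  by move=> _; apply: hΩ2; exact: htt.
have trueP (Y : exLex D) (F : Y ~> Ω) (b : Y ~> one) :
    F = ex_arrow ht ∘ b <-> factors θ (under F).
  split=> [->|h]; last first.
    apply: under_ext; rewrite under_comp0 under_arrow.
    by apply: hΩ2; [exact: h|exact: htt].
  rewrite (hΩ _ _ (tt ∘ under b)); last exact: htt.
  by rewrite under_comp0 under_arrow.
exists Ω, (ex_arrow ht) => U X m hm.
(* [r] is the saturated image of [m] on carriers, and [c0] below is its name in [Λ]. *)
have [S [r hr]] := representable_exists
  (representable_sim (under m ∘ snd) (fst : prod (per_ob X) _ ~> per_ob X)).
have {}hr C (x : C ~> per_ob X) : factors r x <-> exists u, sim (under m ∘ u) x.
  by rewrite hr; split=> [] [u h]; exists u; move: h; rewrite -compA fst_pair snd_pair.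
have [c0 hc] := gen _ _ r.
have {S r hr}hc C (x : C ~> per_ob X) :
    factors θ (c0 ∘ x) <-> exists u, sim (under m ∘ u) x.
  by rewrite -hc hr.
have hX C (a b : C ~> per_ob X) : sim a b -> sim (X := Ω) (c0 ∘ a) (c0 ∘ b).
  move=> hab; apply/hs => C' k; have habk := sim_comp k hab.
  by rewrite -!compA !hc; split=> [] [u h]; exists u; rewrite h // habk.
exists (ex_arrow hX); split.
  split.
    apply/trueP; rewrite (hΩ _ _ (c0 ∘ under m)); first by rewrite under_comp0 under_arrow.
    by apply/hc; exists (idm _); rewrite comp_idr.
  move=> Y a b /trueP; rewrite (hΩ _ _ (c0 ∘ under a)); first by rewrite under_comp0 under_arrow.
  case/hc=> u hu.
  (* The chosen [u] respects the relations because [m] is monic. *)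
  have hh C (v w : C ~> per_ob Y) : sim v w -> sim (u ∘ v) (u ∘ w).
    move=> hvw; apply: (mono_sim hm); rewrite !compA.
    transitivity (under a ∘ v); first exact: sim_comp.
    by rewrite hvw; symmetry; exact: sim_comp.
  have mh : m ∘ ex_arrow hh = a.
    by apply: under_ext; rewrite under_comp0 (under_arrow0 hh) hu.
  exists (ex_arrow hh); split; first by split=> //; exact: bang_uniq.
  by move=> k [hk _]; apply: hm; rewrite hk.
move=> chi [sq uni]; apply: under_ext; rewrite under_arrow0; apply/hs => C k; rewrite hc.
split=> [[u hu]|h].
  rewrite (hΩ _ _ (under (chi ∘ m) ∘ u)).
    by rewrite under_comp hu.
  by apply/factors_comp; apply/(trueP _ _ (bang U)).
(* Where [chi] is true at [k], the pullback property lifts [k] through [m]. *)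
have e : chi ∘ element k = ex_arrow ht ∘ bang _.
  by apply/trueP; rewrite (hΩ _ _ (under chi ∘ k)) // under_comp0 under_element.
have [w [[ew _] _]] := uni _ _ _ e.
by exists (under w); rewrite -(under_comp0 m w) ew under_element.
Qed.

End Topos.

Lemma exlex_topos :
  @has_universals D -> @has_weak_powers D -> IsTopos (exLex D).
Proof.
move=> univ wp.
have [LE] := fin_lim_exists exlex_terminal exlex_pullbacks.
exists LE; split; first by apply: exlex_exponentials => //; exact: universals_wdp.
by apply: exlex_classifier => //; exact: weak_powers_generic.
Qed.

(** * From a topos back to the base category *)

Lemma exlex_image {X J : D} (f : X ~> J) :
  exists (U : exLex D) (m : U ~> discrete J), IsMono m /\
  forall (T : exLex D) (j : T ~> discrete J), factors m j <-> factors f (under j).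
Proof.
(* The image is [X] modulo the kernel pair of [f]. *)
have [R [s [t [eqv hs]]]] : exists (R : D) (s t : R ~> X) eqv,
    forall C (a b : C ~> X), sim (X := @per_of X R s t eqv) a b <-> f ∘ a = f ∘ b.
  apply: (per_exists (Φ := fun C (a b : C ~> X) => _)); last first.
    by move=> C; split=> [//|a b //|a b c -> ->].
  apply: (representable_ext _ (representable_eq (f ∘ fst) (f ∘ snd))) => C c.
  by rewrite -!compA.
pose U : @exLex D L := per_of eqv.
have hf C (a b : C ~> X) : sim (X := U) a b -> sim (X := discrete J) (f ∘ a) (f ∘ b).
  by move/hs/sim_discrete.
pose i : U ~> discrete J := ex_arrow (X := U) (Y := discrete J) hf.
have um (T : exLex D) (h : T ~> U) : under (i ∘ h) = f ∘ under h.
  by apply/sim_discrete; rewrite under_comp0 under_arrow.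
exists U, i; split=> [T a b e|T j].
  by apply/under_ext/hs; rewrite -!um e.
split=> [[h ->]|[u e]]; first by exists (under h); exact: um.
have hu C (a b : C ~> per_ob T) : sim a b -> sim (X := U) (u ∘ a) (u ∘ b).
  by move=> h; apply/hs; rewrite !compA -e; apply/sim_discrete/under_sim.
exists (ex_arrow (Y := U) hu); apply/under_ext/sim_discrete; rewrite um e.
apply: (proj1 (hs _ _ _)); symmetry; exact: under_arrow0.
Qed.

Lemma under_element_discrete {A C : D} (a : C ~> A) :
  under (element (X := discrete A) a) = a.
Proof. by apply/sim_discrete/under_element. Qed.

Lemma under_comp_discrete {X Y : exLex D} {A : D} (G : Y ~> discrete A) (F : X ~> Y) :
  under (G ∘ F) = under G ∘ under F.
Proof. apply/sim_discrete; exact: under_comp0. Qed.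

Lemma element_comp {X : exLex D} {B C : D} (f : B ~> per_ob X) (a : C ~> B) :
  element f ∘ element (X := discrete B) a = element (f ∘ a).
Proof. by rewrite comp_element; apply/element_sim/under_arrow. Qed.

Lemma factors2_element {A B C : D} {N : exLex D} (s : N ~> discrete A) (t : N ~> discrete B)
    (a : C ~> A) (b : C ~> B) :
  factors2 s t (element (X := discrete A) a) (element (X := discrete B) b) <->
  factors2 (under s) (under t) a b.
Proof.
split=> [[u [ea eb]]|[u [-> ->]]]; last by exists (element u); rewrite !comp_element.
exists (under u); rewrite -(under_element_discrete a) -(under_element_discrete b) ea eb.
by split; [exact: (under_comp_discrete s u)|exact: (under_comp_discrete t u)].
Qed.

Lemma factors2_pb {E : Category} {LE : FinLim E} {X Y Y' M C : E} (m1 : M ~> X)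
    (m2 : M ~> Y) (g : Y' ~> Y) (x : C ~> X) (y : C ~> Y') :
  factors2 m1 m2 x (g ∘ y) <-> factors2 (m1 ∘ pb1 m2 g) (pb2 m2 g) x y.
Proof.
split=> [[u [-> e]]|[u [-> ->]]].
  by exists (pb_pair (esym e)); rewrite -compA pb_pair1 pb_pair2.
by exists (pb1 m2 g ∘ u); rewrite !compA pb_sq.
Qed.

Lemma topos_exlex :
  IsTopos (exLex D) -> @has_universals D /\ @has_weak_powers D.
Proof.
case=> LE [ex cl]; split=> [X J I f g|X].
  have [U [m [hm hf]]] := exlex_image f.
  have [V [n hn]] := topos_universals ex cl (element (X := discrete I) g) hm.
  exists (per_ob V), (under n) => C a.
  have -> : factors (under n) a <-> factors n (element (X := discrete I) a).
    split=> [[u ->]|[u e]]; first by exists (element u); rewrite comp_element.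
    exists (under u); rewrite -{1}(under_element_discrete a) e.
    exact: (under_comp_discrete n u).
  (* Stages of [D] are discrete stages; conversely, a test from [T] is carried out on the carrier of
     [T]. *)
  rewrite hn; split=> [h C' k j e|h T k j /(f_equal under) e].
    rewrite -(under_element_discrete j).
    apply: (proj1 (hf (discrete C') (element (X := discrete J) j))).
    by apply: (h _ (element (X := discrete C) k)); rewrite !element_comp e.
  apply/hf/(h _ (under k)).
  transitivity (under (element (X := discrete I) g ∘ j)).
    by apply/sim_discrete; rewrite under_comp0 under_arrow.
  by rewrite e; apply/sim_discrete; rewrite under_comp0 under_arrow.
have [PX [M [m1 [m2 [tr _]]]]] := topos_powers ex cl (discrete X).
(* The power object is covered by its carrier, and membership is pulled back along this cover. *)
pose cov : discrete (per_ob PX) ~> PX := element (idm _).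
exists (per_ob PX), (per_ob (pb m2 cov)).
exists (under (m1 ∘ pb1 m2 cov)), (under (pb2 m2 cov)) => Y B b1 b2.
have [U [m [hm hb]]] := exlex_image (pair b1 b2).
have uf (T : exLex D) A A' (f : A ~> A') (j : T ~> discrete A) :
    under (element (X := discrete A') f ∘ j) = f ∘ under j.
  by apply/sim_discrete; rewrite under_comp0 under_arrow.
have ext (T : exLex D) (j j' : T ~> discrete (prod X Y)) :
    element (X := discrete X) fst ∘ j = element (X := discrete X) fst ∘ j' ->
    element (X := discrete Y) snd ∘ j = element (X := discrete Y) snd ∘ j' -> j = j'.
  move=> /(f_equal under) e1 /(f_equal under) e2; apply/under_ext/sim_discrete.
  by rewrite !uf in e1 e2; exact: prod_ext.
have [|chi hc] := tr (discrete Y) U (element (X := discrete X) fst ∘ m)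
    (element (X := discrete Y) snd ∘ m).
  move=> T a b; rewrite !pair_comp => /pair_inj []; rewrite -!compA => e2 e1.
  by apply: hm; exact: ext.
(* A representative of [chi] lifts it along the cover, as [discrete Y] is projective. *)
exists (under chi) => C x y.
rewrite -factors2_element -factors2_pb /cov element_comp comp_idl.
rewrite -(comp_element chi (y : C ~> per_ob (discrete Y))) -hc.
rewrite -factors_pair -(under_element_discrete (pair x y)).
rewrite -(hb (discrete C) (element (X := discrete (prod X Y)) (pair x y))).
split=> [[u e]|[u [e1 e2]]]; exists u.
  by rewrite -!compA -e !element_comp fst_pair snd_pair.
by apply: ext; rewrite element_comp ?fst_pair ?snd_pair compA.
Qed.

Lemma exlex_toposP :
  IsTopos (exLex D) <-> @has_universals D /\ @has_weak_powers D.
Proof. by split=> [|[]]; [exact: topos_exlex|exact: exlex_topos]. Qed.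

End ExLex.

(** * Equivalence of the four conditions *)

Theorem theorem6p2 (C : Category) (L : FinLim C) (P : Doctrine C) :
  (ExSupercompactifiable P <-> FullTripos (weakSubobject (points P))) /\
  (FullTripos (weakSubobject (points P)) <-> FullTripos (existentialCompletion P)) /\
  (FullTripos (existentialCompletion P) <-> IsTopos (exactPoints P)).
Proof.
rewrite /ExSupercompactifiable wdp_genericP weak_subobject_triposP completion_triposP.
by rewrite exlex_toposP.
Qed.
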